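(* In the setting below, assume the path $(Z_1,Z_2)$ minimizes the action, $Z_1(0)=0$, $Z_2(0)\neq0$ lies on the positive $x$-axis, $Z_1(1)\in\overline{\mathsf{Q}_1}$ and $Z_2(1)\in\overline{\mathsf{Q}_4}$. If $Z_1(1)\in\mathsf{Q}_1$ or $Z_2(1)\in\mathsf{Q}_4$, then $Z_1(t)\in\overline{\mathsf{Q}_1}$ and $Z_2(t)\in\overline{\mathsf{Q}_4}$ for all $t\in[0,1]$, i.e. $Z_i(t)=\widetilde Z_i(t)$ for all $t\in[0,1]$, $i=1,2$. If both $Z_1(1)$ and $Z_2(1)$ lie on the positive $x$-axis, then either $Z_1(t)\in\overline{\mathsf{Q}_1}$ and $Z_2(t)\in\overline{\mathsf{Q}_4}$ for all $t\in[0,1]$, or $Z_1(t)\in\overline{\mathsf{Q}_4}$ and $Z_2(t)\in\overline{\mathsf{Q}_1}$ for all $t\in[0,1]$.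
   Context: Planar three-body problem with masses $m_1=m_2=m_3=1$, $\chi=\{q=(q_1,q_2,q_3)\in(\mathbb{R}^2)^3: q_1+q_2+q_3=0\}$. Let $Q_{S_4}=\{q: q_1=q_2=(-a_2,0),\ q_3=(2a_2,0),\ a_2\ge0\}$ and $Q_{E_1}=\{q: q_1=(0,-2b_1),\ q_2=(-b_2,b_1),\ q_3=(b_2,b_1),\ b_1,b_2\in\mathbb{R}\}$. The path $q$ minimizes $\mathcal{A}(q)=\int_0^1\big(\tfrac12\sum|\dot q_i|^2+\sum_{i<j}\frac{1}{|q_i-q_j|}\big)dt$ over $\{q\in H^1([0,1],\chi): q(0)\in Q_{S_4},\ q(1)\in Q_{E_1}\}$; it is collision-free for $t\in(0,1]$ and satisfies Newton's equations there. Jacobi coordinates $Z_1=q_1-q_2=(Z_{1x},Z_{1y})$, $Z_2=q_3-\frac{q_1+q_2}{2}=(Z_{2x},Z_{2y})$. $\widetilde Z_1(t)=(|Z_{1x}(t)|,|Z_{1y}(t)|)$, $\widetilde Z_2(t)=(|Z_{2x}(t)|,-|Z_{2y}(t)|)$. $\mathsf{Q}_i$ is the open $i$-th quadrant of the plane (e.g. $\mathsf{Q}_1=\{x>0,y>0\}$) and $\overline{\mathsf{Q}_i}$ its closure. *)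

(* Defs.v *)
From HB Require Import structures.
From mathcomp Require Import all_boot all_order all_algebra.
From mathcomp Require Import all_classical all_reals all_analysis.
Set Implicit Arguments. Unset Strict Implicit. Unset Printing Implicit Defensive.
Import Order.TTheory GRing.Theory Num.Theory.
Local Open Scope classical_set_scope.
Local Open Scope ring_scope.

Section ThreeBody.
Variable R : realType.

(* A point of the plane is a pair (x, y). A path of the three bodies is
   q : 'I_3 -> R -> R * R, q i t = position of body i+1 at time t. *)
Definition pt := (R * R)%type.
Definition path3 := 'I_3 -> R -> pt.

Definition b1 : 'I_3 := @Ordinal 3 0 isT.
Definition b2 : 'I_3 := @Ordinal 3 1 isT.
Definition b3 : 'I_3 := @Ordinal 3 2 isT.

Definition padd (a b : pt) : pt := (a.1 + b.1, a.2 + b.2).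
Definition psub (a b : pt) : pt := (a.1 - b.1, a.2 - b.2).
Definition pscale (c : R) (a : pt) : pt := (c * a.1, c * a.2).
Definition pnorm2 (a : pt) : R := a.1 ^+ 2 + a.2 ^+ 2.
Definition pnorm (a : pt) : R := Num.sqrt (pnorm2 a).

Definition in_chi (c : 'I_3 -> pt) : Prop :=
  padd (padd (c b1) (c b2)) (c b3) = (0, 0).

Definition in_QS4 (c : 'I_3 -> pt) : Prop :=
  exists a2 : R, 0 <= a2 /\ c b1 = (- a2, 0) /\ c b2 = (- a2, 0)
                 /\ c b3 = (2 * a2, 0).

Definition in_QE1 (c : 'I_3 -> pt) : Prop :=
  exists b1' b2' : R, c b1 = (0, - (2 * b1')) /\ c b2 = (- b2', b1')
                      /\ c b3 = (b2', b1').

(* H^1([0,1], (R^2)^3) with weak derivative v: every coordinate of v is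
   measurable and square-integrable on [0,1], and q is the primitive of v. *)
Definition H1_with_deriv (q v : path3) : Prop :=
  forall i : 'I_3,
    measurable_fun `[(0%R:R), (1%R:R)] (fun s => (v i s).1) /\
    measurable_fun `[(0%R:R), (1%R:R)] (fun s => (v i s).2) /\
    (\int[lebesgue_measure]_(s in `[(0%R:R), (1%R:R)]) ((v i s).1 ^+ 2)%:E < +oo)%E /\
    (\int[lebesgue_measure]_(s in `[(0%R:R), (1%R:R)]) ((v i s).2 ^+ 2)%:E < +oo)%E /\
    forall t, (0 <= t <= 1)%R ->
      (q i t).1 = (q i 0).1 + Rintegral lebesgue_measure `[(0%R:R), t] (fun s => (v i s).1) /\
      (q i t).2 = (q i 0).2 + Rintegral lebesgue_measure `[(0%R:R), t] (fun s => (v i s).2).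

Definition admissible (q v : path3) : Prop :=
  H1_with_deriv q v /\
  (forall t, (0 <= t <= 1)%R -> in_chi (fun i => q i t)) /\
  in_QS4 (fun i => q i 0) /\ in_QE1 (fun i => q i 1).

Definition inv_dist (a b : pt) : \bar R :=
  if a == b then +oo%E else ((pnorm (psub a b))^-1)%:E.

Definition lagrangian (q v : path3) (t : R) : \bar R :=
  ((2^-1 * (pnorm2 (v b1 t) + pnorm2 (v b2 t) + pnorm2 (v b3 t)))%:E
   + inv_dist (q b1 t) (q b2 t) + inv_dist (q b1 t) (q b3 t)
   + inv_dist (q b2 t) (q b3 t))%E.

Definition action (q v : path3) : \bar R :=
  (\int[lebesgue_measure]_(t in `[(0%R:R), (1%R:R)]) lagrangian q v t)%E.

Definition is_minimizer (q v : path3) : Prop :=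
  admissible q v /\ forall p w, admissible p w -> (action q v <= action p w)%E.

Definition collision_free_on_0_1 (q : path3) : Prop :=
  forall t, (0 < t <= 1)%R ->
    q b1 t != q b2 t /\ q b1 t != q b3 t /\ q b2 t != q b3 t.

(* Jacobi coordinates *)
Definition Z1 (q : path3) (t : R) : pt := psub (q b1 t) (q b2 t).
Definition Z2 (q : path3) (t : R) : pt :=
  psub (q b3 t) (pscale (2^-1) (padd (q b1 t) (q b2 t))).

Definition inQ1 (a : pt) : Prop := 0 < a.1 /\ 0 < a.2.
Definition inQ4 (a : pt) : Prop := 0 < a.1 /\ a.2 < 0.
Definition inQ1bar (a : pt) : Prop := 0 <= a.1 /\ 0 <= a.2.
Definition inQ4bar (a : pt) : Prop := 0 <= a.1 /\ a.2 <= 0.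
Definition on_pos_xaxis (a : pt) : Prop := 0 < a.1 /\ a.2 = 0.

End ThreeBody.

(* Main.v *)
Require Import Defs.
From HB Require Import structures.
From mathcomp Require Import all_boot all_order all_algebra.
From mathcomp Require Import all_classical all_reals all_analysis.
From mathcomp Require Import measurable_realfun ring lra.
Set Implicit Arguments. Unset Strict Implicit. Unset Printing Implicit Defensive.
Import Order.TTheory GRing.Theory Num.Theory.
Import numFieldNormedType.Exports.
Local Open Scope classical_set_scope.
Local Open Scope ring_scope.

(* In Jacobi coordinates the Lagrangian is
   [1/4 |Z1'|^2 + 1/3 |Z2'|^2 + 1/|Z1| + 1/|Z2 - Z1/2| + 1/|Z2 + Z1/2|],
   and the last two terms increase with [|Z1.Z2|] when [|Z1|] and [|Z2|] are
   fixed. Hence replacing [Z] by [tilde Z] does not increase the action, and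
   [tilde Z] is again a minimizer. Perturbing a minimizer by a small tent function
   shows that its symmetric second differences converge to the forces; so it
   solves Newton's equations on (0,1), and a coordinate of [Z] can only vanish
   there with vanishing derivative, otherwise [tilde Z] would have a corner.
   Since the equations are [Z1'' = - a Z1 + b (Z1.Z2) Z2],
   [Z2'' = - a' Z2 + b' (Z1.Z2) Z1] with [b, b' > 0], two coordinates vanishing
   together lie in an invariant subspace of a linear system, which the end
   conditions exclude except for collinear motion on the x-axis; and an isolated
   zero is a strict local extremum, so no coordinate changes sign. That [Z1y] and
   [Z2y] have opposite signs follows by comparing Newton's equations for [Z] and
   [tilde Z]. *)

(** * Symmetric second differences *)

Section SecondDifference.
Variable R : realType.
Implicit Types (f g G w W : R -> R) (a b c d h t x l m eta : R).

(** The order of the argument is forced by regularity. The path [tilde Z] is a competitor only if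
    [|Z j d|] lies in H^1 with derivative [sg (Z j d) * V j d], and [is_H1_abs] takes this from C^1
    regularity inside (0,1). So Newton's equations must be reached for [Z] before any reflection,
    while [Z] is merely H^1. Symmetric second differences serve this purpose: they need no
    derivative of the path, and they are exactly what the kinetic energy yields when tested against
    a tent. Differential statements stay on the open interval, because bodies 1 and 2 collide at
    time 0; signs and identities reach the endpoints by continuity only. Finally, minimality carries
    information only if the minimal action is finite, so a competitor of finite action that leaves
    the collision has to be exhibited; its mutual distance grows like [t^(2/3)], the rate of
    parabolic Kepler ejection. *)

Definition diff2 f c h : R := f (c + h) + f (c - h) - 2 * f c.

(** The Riemann-Schwarz second derivative, with the division by [h ^+ 2] cleared. It involves values
    of [f] only, so it makes sense for a path of unknown regularity. *)
Definition schwarz_derive f c (l : R) : Prop :=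
  forall eta, 0 < eta -> exists2 h0, 0 < h0 &
    forall h, 0 < h < h0 -> `|diff2 f c h - h ^+ 2 * l| <= eta * h ^+ 2.

Lemma schwarz_deriveB f g c l m :
  schwarz_derive f c l -> schwarz_derive g c m ->
  schwarz_derive (fun x => f x - g x) c (l - m).
Proof.
move=> sf sg eta eta0.
have e2 : 0 < eta / 2 by rewrite divr_gt0.
have [h1 h10 H1] := sf _ e2; have [h2 h20 H2] := sg _ e2.
exists (Num.min h1 h2); first by rewrite lt_min h10 h20.
move=> h /andP[h0]; rewrite lt_min => /andP[hh1 hh2].
have := H1 h; rewrite h0 hh1 => /(_ isT) K1.
have := H2 h; rewrite h0 hh2 => /(_ isT) K2.
have -> : diff2 (fun x => f x - g x) c h - h ^+ 2 * (l - m) =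
  (diff2 f c h - h ^+ 2 * l) - (diff2 g c h - h ^+ 2 * m).
  by rewrite /diff2; ring.
by rewrite (le_trans (ler_normB _ _))//; lra.
Qed.

Lemma schwarz_derive_affine c (k1 k2 : R) :
  schwarz_derive (fun x => k1 + k2 * x) c 0.
Proof.
move=> eta eta0; exists 1 => // h /andP[h0 _].
rewrite /diff2 mulr0 subr0 (_ : _ - _ = 0) ?normr0; last by ring.
by rewrite mulr_ge0 ?sqr_ge0// ltW.
Qed.

Lemma schwarz_derive_unique f c l m :
  schwarz_derive f c l -> schwarz_derive f c m -> l = m.
Proof.
move=> sl sm; apply/eqP; rewrite -subr_eq0 -normr_le0.
apply/ler_addgt0Pl => e e0; rewrite addr0.
have e2 : 0 < e / 2 by rewrite divr_gt0.
have [h1 h10 H1] := sl _ e2; have [h2 h20 H2] := sm _ e2.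
pose h := Num.min h1 h2 / 2.
have h0 : 0 < h by rewrite divr_gt0 // lt_min h10.
have hm : h < Num.min h1 h2 by rewrite /h; move: h0; rewrite /h; lra.
move: (hm); rewrite lt_min => /andP[hh1 hh2].
have := H1 h; rewrite h0 hh1 => /(_ isT) K1.
have := H2 h; rewrite h0 hh2 => /(_ isT) K2.
have h20' : 0 < h ^+ 2 by rewrite exprn_gt0.
rewrite -(ler_pM2r h20') -[X in `|_| * X](gtr0_norm h20') -normrM.
have -> : (l - m) * h ^+ 2 = (diff2 f c h - h ^+ 2 * m) - (diff2 f c h - h ^+ 2 * l) by ring.
rewrite (le_trans (ler_normB _ _))//.
have : e / 2 * h ^+ 2 + e / 2 * h ^+ 2 = e * h ^+ 2 by field.
lra.
Qed.

(** Schwarz's argument: if [g] were positive somewhere, adding a small convex parabola that vanishes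
    at [a] and [b] would leave an interior maximum, where second differences are nonpositive. Those
    of the parabola are [2 * e * h ^+ 2], which outweighs the error [e * h ^+ 2] allowed for [g]. *)
Lemma schwarz_derive0_le0 g a b : a < b -> {within `[a, b], continuous g} ->
  g a = 0 -> g b = 0 ->
  (forall c, a < c < b -> schwarz_derive g c 0) ->
  forall t, a <= t <= b -> g t <= 0.
Proof.
move=> ab cg ga gb sg t tab; rewrite leNgt; apply/negP => gt0.
(* As [(t - a) * (b - t) <= (b - a) ^+ 2], the parabola costs at most [g t / 2] at [t], so [k t]
   stays positive. *)
pose e := g t / (2 * (b - a) ^+ 2).
have ba0 : 0 < b - a by rewrite subr_gt0.
have e0 : 0 < e by rewrite divr_gt0// mulr_gt0// exprn_gt0.
pose k x := g x + e * ((x - a) * (x - b)).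
have ck : {within `[a, b], continuous k}.
  move=> x; apply: cvgD; first exact: cg.
  apply: (@continuous_subspaceT _ _ _ (fun x => e * ((x - a) * (x - b)))).
  move=> y; apply: cvgM; first exact: cvg_cst.
  by apply: cvgM; apply: cvgB; (exact: cvg_id || exact: cvg_cst).
have [c cab kmax] := EVT_max (ltW ab) ck.
have kt : 0 < k t.
  have : e * (2 * (b - a) ^+ 2) = g t.
    by rewrite /e mulfVK// mulf_neq0// expf_neq0// gt_eqF.
  rewrite /k; move: tab => /andP[h1 h2] h3.
  have : 0 <= (t - a) * (b - t) <= (b - a) ^+ 2 by apply/andP; split; nra.
  move=> /andP[h4 h5]; nra.
have kc : 0 < k c by rewrite (lt_le_trans kt)// kmax// in_itv.
move: cab; rewrite in_itv/= => /andP[ac cb].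
have ac' : a < c.
  rewrite lt_neqAle ac andbT; apply/eqP => ea.
  by move: kc; rewrite -ea /k ga subrr mul0r mulr0 addr0 ltxx.
have cb' : c < b.
  rewrite lt_neqAle cb andbT; apply/eqP => ea.
  by move: kc; rewrite ea /k gb subrr !mulr0 addr0 ltxx.
have [|h1 h10 H] := sg c _ e e0; first by rewrite ac'.
pose h := Num.min (Num.min h1 (c - a)) (b - c) / 2.
have m0 : 0 < Num.min (Num.min h1 (c - a)) (b - c).
  by rewrite !lt_min h10 !subr_gt0 ac'.
have h0 : 0 < h by rewrite divr_gt0.
have : h < Num.min (Num.min h1 (c - a)) (b - c) by rewrite /h; lra.
rewrite !lt_min => /andP[/andP[hh1 hca] hbc].
have := H h; rewrite h0 hh1 => /(_ isT).
rewrite mulr0 subr0 ler_norml => /andP[K _].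
have k1 : k (c + h) <= k c by apply: kmax; rewrite in_itv/=; apply/andP; split; lra.
have k2 : k (c - h) <= k c by apply: kmax; rewrite in_itv/=; apply/andP; split; lra.
have : diff2 k c h = diff2 g c h + 2 * e * h ^+ 2 by rewrite /diff2 /k; ring.
have : 0 < e * h ^+ 2 by rewrite mulr_gt0// exprn_gt0.
have : diff2 k c h <= 0 by rewrite /diff2; lra.
lra.
Qed.

Lemma schwarz_derive0_eq0 g a b : a < b -> {within `[a, b], continuous g} ->
  g a = 0 -> g b = 0 ->
  (forall c, a < c < b -> schwarz_derive g c 0) ->
  forall t, a <= t <= b -> g t = 0.
Proof.
move=> ab cg ga gb sg t tab; apply/eqP; rewrite eq_le.
rewrite (schwarz_derive0_le0 ab cg ga gb sg tab)/=.
rewrite -oppr_le0.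
apply: (@schwarz_derive0_le0 (fun x => - g x) a b) => //.
- by move=> x; apply: cvgN; exact: cg.
- by rewrite ga oppr0.
- by rewrite gb oppr0.
move=> c cab; have := schwarz_deriveB (schwarz_derive_affine c 0 0) (sg c cab).
rewrite subr0; congr (schwarz_derive _ _ _).
by apply/funext => x; rewrite mul0r !add0r.
Qed.

End SecondDifference.

(** * From continuous symmetric second derivatives to C^2 regularity *)

Section C2.
Variable R : realType.
Implicit Types (f g G w W : R -> R) (a b c d h t x l m eta : R).
Local Notation mu := (@lebesgue_measure R).

Lemma is_derive1_continuous f x l : is_derive x 1 f l -> {for x, continuous f}.
Proof.
by move=> [df _]; apply: differentiable_continuous; exact/derivable1_diffP.
Qed.

Lemma derivable_is_derive1 f x : derivable f x 1 -> is_derive x 1 f (derive1 f x).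
Proof. by move=> df; rewrite derive1E; exact: derivableP. Qed.

Lemma is_derive1D f g x l m : is_derive x 1 f l -> is_derive x 1 g m ->
  is_derive x 1 (fun y => f y + g y) (l + m).
Proof. by move=> df dg; exact: is_deriveD. Qed.

Lemma is_derive1B f g x l m : is_derive x 1 f l -> is_derive x 1 g m ->
  is_derive x 1 (fun y => f y - g y) (l - m).
Proof. by move=> df dg; exact: is_deriveB. Qed.

Lemma is_derive1M f g x l m : is_derive x 1 f l -> is_derive x 1 g m ->
  is_derive x 1 (fun y => f y * g y) (l * g x + f x * m).
Proof.
move=> df dg; rewrite (_ : _ + _ = f x *: m + g x *: l).
  exact: is_deriveM.
by rewrite addrC [l * _]mulrC.
Qed.

Lemma is_derive1_id x : is_derive x 1 (fun y => y) 1.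
Proof. exact: is_derive_id. Qed.

Lemma is_derive1_dist f c l : is_derive c 1 f l -> forall eta, 0 < eta ->
  exists2 d, 0 < d & forall x, `|x - c| < d ->
    `|f x - f c - l * (x - c)| <= eta * `|x - c|.
Proof.
move=> /is_derive1_caratheodory[g [fg cg <-]] eta eta0.
have /cvgrPdist_le /(_ _ eta0) /nbhs_ballP[d /= d0 dP] := cg.
exists d => // x xc.
rewrite fg -mulrBl normrM ler_wpM2r// distrC; apply: dP.
by rewrite /ball/= distrC.
Qed.

Lemma is_derive1_affine (k1 k2 x : R) :
  is_derive x 1 (fun y => k1 + k2 * y) k2.
Proof.
apply/is_derive1_caratheodory; exists (cst k2); split => //.
  by move=> z /=; ring.
exact: cst_continuous.
Qed.

(** The mean value theorem applied to [psi x = diff2 W c x - x ^+ 2 * l], with [psi 0 = 0], leaves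
    [w (c + z) - w (c - z) - 2 * z * l], which is o(z) because [w] is differentiable at [c]. *)
Lemma schwarz_derive_C2 W w c l d : 0 < d ->
  (forall x, `|x - c| < d -> is_derive x 1 W (w x)) ->
  is_derive c 1 w l -> schwarz_derive W c l.
Proof.
move=> d0 dW dw eta eta0.
have e2 : 0 < eta / 2 by rewrite divr_gt0.
have [d1 d10 H] := is_derive1_dist dw e2.
exists (Num.min d d1); first by rewrite lt_min d0.
move=> h /andP[h0]; rewrite lt_min => /andP[hd hd1].
pose psi x := diff2 W c x - x ^+ 2 * l.
pose dpsi x := w (c + x) - w (c - x) - 2 * x * l.
have dpsiP x : `|x| < d -> is_derive x 1 psi (dpsi x).
  move=> xd.
  have W1 : is_derive x 1 (W \o (fun x => c + 1 * x)) (w (c + x)).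
    rewrite -[w _]mulr1; apply: is_derive1_comp; last exact: is_derive1_affine.
    by rewrite mul1r; apply: dW; rewrite addrC addKr.
  have W2 : is_derive x 1 (W \o (fun x => c + -1 * x)) (- w (c - x)).
    rewrite -[- w _]mulrN1; apply: is_derive1_comp; last exact: is_derive1_affine.
    by rewrite mulN1r; apply: dW; rewrite addrC addKr normrN.
  have W0 : is_derive x 1 (fun=> 2 * W c) 0 by exact: is_derive_cst.
  have D := is_derive1B (is_derive1B (is_derive1D W1 W2) W0)
    (is_derive1M (is_derive1M (is_derive1_id x) (is_derive1_id x))
                 (is_derive_cst l x 1)).
  have -> : psi = (fun y => (W \o (fun x => c + 1 * x)) y +
     (W \o (fun x => c + -1 * x)) y - 2 * W c - y * y * cst l y).
    by apply/funext => y; rewrite /psi /diff2/= mul1r mulN1r expr2.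
  by rewrite (_ : dpsi x = w (c + x) + - w (c - x) - 0 -
    ((1 * x + x * 1) * cst l x + x * x * 0))// /dpsi/=; ring.
have cpsi : {within `[0, h], continuous psi}.
  apply: continuous_in_subspaceT => x; rewrite inE/= in_itv/= => /andP[x0 xh].
  apply: is_derive1_continuous; apply: dpsiP.
  by rewrite ger0_norm// (le_lt_trans xh).
have [z zh] : exists2 z, z \in `]0, h[ & psi h - psi 0 = dpsi z * (h - 0).
  apply: MVT => // x; rewrite in_itv/= => /andP[x0 xh].
  by apply: dpsiP; rewrite gtr0_norm// (lt_trans xh).
rewrite subr0 /psi expr0n/= mul0r subr0 /diff2 addr0 subr0.
rewrite (_ : W c + W c - 2 * W c = 0); last by ring.
rewrite subr0 => ->.
move: zh; rewrite in_itv/= => /andP[z0 zh].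
rewrite normrM (gtr0_norm h0) expr2 mulrA ler_wpM2r//; first exact: ltW.
have zd1 : z < d1 by exact: lt_trans hd1.
have K1 : `|w (c + z) - w c - l * z| <= eta / 2 * z.
  have := H (c + z); rewrite (_ : c + z - c = z); last by ring.
  by rewrite (gtr0_norm z0); exact.
have K2 : `|w (c - z) - w c - l * (- z)| <= eta / 2 * z.
  have := H (c - z); rewrite (_ : c - z - c = - z); last by ring.
  by rewrite normrN (gtr0_norm z0); exact.
have -> : dpsi z = (w (c + z) - w c - l * z) - (w (c - z) - w c - l * (- z)).
  by rewrite /dpsi; ring.
rewrite (le_trans (ler_normB _ _))//.
have : eta / 2 * z <= eta / 2 * h by rewrite ler_wpM2l// ltW.
lra.
Qed.

(** Subtract from [f] a twofold primitive [W] of [G]: the remainder has zero symmetric second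
    derivative, hence is affine by Schwarz's argument, and [f] inherits the smoothness of [W]. *)
Lemma schwarz_derive_is_derive2 f G :
  (forall t, 0 < t < 1 -> {for t, continuous f}) ->
  (forall t, 0 < t < 1 -> {for t, continuous G}) ->
  (forall t, 0 < t < 1 -> schwarz_derive f t (G t)) ->
  forall t, 0 < t < 1 -> is_derive t 1 f (derive1 f t) /\ is_derive t 1 (derive1 f) (G t).
Proof.
move=> cf cG sf t /andP[t0 t1].
(* Continuity is known on the open interval only, so the primitives are taken on a compact
   subinterval around [t]. *)
pose a := t / 2; pose b := (1 + t) / 2.
have [a0 at_ tb b1] : [/\ 0 < a, a < t, t < b & b < 1].
  by rewrite /a /b; split; lra.
have ab : a < b by exact: lt_trans tb.
have sub x : a <= x <= b -> 0 < x < 1.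
  by move=> /andP[ax xb]; rewrite (lt_le_trans a0)//= (le_lt_trans xb).
have wc (k : R -> R) : (forall t, 0 < t < 1 -> {for t, continuous k}) ->
    {within `[a, b], continuous k}.
  move=> ck; apply: continuous_in_subspaceT => x; rewrite inE/= in_itv/= => xab.
  exact/ck/sub.
have iG : mu.-integrable `[a, b] (EFin \o G).
  by apply: continuous_compact_integrable; [exact: segment_compact|exact: wc].
pose w x := \int[mu]_(s in `[a, x]) G s.
have dw x : a < x < b -> is_derive x 1 w (G x).
  move=> /andP[ax xb].
  have [|d1 d2] := continuous_FTC1_closed xb iG ax.
    by apply: cG; apply: sub; rewrite !ltW.
  by rewrite -d2; exact: derivable_is_derive1.
have cw : {within `[a, b], continuous w}.
  exact: (parameterized_integral_continuous (ltW ab)).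
have iw : mu.-integrable `[a, b] (EFin \o w).
  by apply: continuous_compact_integrable => //; exact: segment_compact.
pose W x := \int[mu]_(s in `[a, x]) w s.
have dW x : a < x < b -> is_derive x 1 W (w x).
  move=> /andP[ax xb].
  have [|d1 d2] := continuous_FTC1_closed xb iw ax.
    by apply: is_derive1_continuous; apply: dw; rewrite ax.
  by rewrite -d2; exact: derivable_is_derive1.
have cW : {within `[a, b], continuous W}.
  exact: (parameterized_integral_continuous (ltW ab)).
pose g0 x := f x - W x.
(* The chord of [g0] is removed so that [g] vanishes at both ends. *)
pose k2 := (g0 b - g0 a) / (b - a).
pose k1 := g0 a - k2 * a.
pose g x := g0 x - (k1 + k2 * x).
have k2P : k2 * (b - a) = g0 b - g0 a by rewrite /k2 mulfVK// subr_eq0 gt_eqF.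
have g_0 x : a <= x <= b -> g x = 0.
  apply: schwarz_derive0_eq0 => //.
  - move=> y; apply: cvgB.
      by apply: cvgB; [exact: wc|exact: cW].
    apply: (@continuous_subspaceT _ _ _ (fun x => k1 + k2 * x)).
    move=> z; apply: cvgD; first exact: cvg_cst.
    by apply: cvgM; (exact: cvg_id || exact: cvg_cst).
  - by rewrite /g /k1; ring.
  - have -> : g b = (g0 b - g0 a) - k2 * (b - a) by rewrite /g /k1; ring.
    by rewrite k2P subrr.
  move=> c /andP[ac cb]; rewrite -[0](subr0 0).
  apply: schwarz_deriveB; last exact: schwarz_derive_affine.
  rewrite -(subrr (G c)); apply: schwarz_deriveB.
    by apply: sf; apply: sub; rewrite !ltW.
  have cm0 : 0 < Num.min (c - a) (b - c) by rewrite lt_min !subr_gt0 ac.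
  apply: (@schwarz_derive_C2 W w c _ _ cm0); last by apply: dw; rewrite ac.
  move=> y; rewrite lt_min !ltr_norml => /andP[/andP[? ?] /andP[? ?]].
  by apply: dW; apply/andP; split; lra.
have fE x : a <= x <= b -> f x = W x + (k1 + k2 * x).
  by move=> xab; have := g_0 x xab; rewrite /g /g0; lra.
have nab x : a < x < b -> \forall y \near x, a <= y <= b.
  move=> xab; have : x \in `]a, b[ by rewrite in_itv.
  move=> /near_in_itvoo; apply: filterS => y; rewrite in_itv/= => /andP[? ?].
  by rewrite !ltW.
have nab' x : a < x < b -> \forall y \near x, a < y < b.
  move=> xab; have : x \in `]a, b[ by rewrite in_itv.
  by move=> /near_in_itvoo; apply: filterS => y; rewrite in_itv.
have df x : a < x < b -> is_derive x 1 f (w x + k2).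
  move=> xab; apply: (@near_eq_is_derive _ _ _ (fun y => W y + (k1 + k2 * y))).
    by have := nab _ xab; apply: filterS => y /fE ->.
  have := dW _ xab => dWx.
  have := is_derive1_affine k1 k2 x => da.
  exact: is_derive1D.
have tab : a < t < b by rewrite at_.
have df1 x : a < x < b -> derive1 f x = w x + k2.
  by move=> xab; rewrite derive1E; have [_] := df _ xab.
split; first by rewrite df1//; exact: df.
apply: (@near_eq_is_derive _ _ _ (fun y => w y + k2)).
  by have := nab' _ tab; apply: filterS => y /df1 ->.
have := dw _ tab => dwt.
by rewrite -[G t]addr0; apply: is_derive1D => //; exact: is_derive_cst.
Qed.

End C2.

(** * Zeros of solutions and constancy of sign *)

Section Zeros.
Variable R : realType.
Implicit Types (f g G w W : R -> R) (a b c d h t x l m eta : R).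

Lemma bounded_on_segment f a b : a <= b -> {within `[a, b], continuous f} ->
  exists2 M, 0 <= M & forall x, a <= x <= b -> `|f x| <= M.
Proof.
move=> ab cf.
have cnf : {within `[a, b], continuous (fun x => `|f x|)}.
  by move=> x; apply: cvg_norm; exact: cf.
have [c _ H] := EVT_max ab cnf; by exists `|f c|.
Qed.

(* [E exp(-M t)] is nonincreasing and [E exp(M t)] nondecreasing, where
   [E = f^2 + f'^2 + g^2 + g'^2] and [M] bounds the coefficients. *)
Lemma linear_system_unique f f1 g g1 (a11 a12 a21 a22 : R -> R) t0 :
  (forall t, 0 < t < 1 -> is_derive t 1 f (f1 t)) ->
  (forall t, 0 < t < 1 -> is_derive t 1 g (g1 t)) ->
  (forall t, 0 < t < 1 -> is_derive t 1 f1 (a11 t * f t + a12 t * g t)) ->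
  (forall t, 0 < t < 1 -> is_derive t 1 g1 (a21 t * f t + a22 t * g t)) ->
  (forall t, 0 < t < 1 -> {for t, continuous a11}) ->
  (forall t, 0 < t < 1 -> {for t, continuous a12}) ->
  (forall t, 0 < t < 1 -> {for t, continuous a21}) ->
  (forall t, 0 < t < 1 -> {for t, continuous a22}) ->
  0 < t0 < 1 -> f t0 = 0 -> f1 t0 = 0 -> g t0 = 0 -> g1 t0 = 0 ->
  forall t, 0 < t < 1 -> f t = 0 /\ g t = 0.
Proof.
move=> df dg df1 dg1 c11 c12 c21 c22 t001 f0 f10 g0 g10 t t01.
pose a := Num.min t t0; pose b := Num.max t t0.
have ab : a <= b by rewrite ge_min le_max lexx.
have a0 : 0 < a by rewrite lt_min; move: t01 t001 => /andP[-> _] /andP[-> _].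
have b1 : b < 1 by rewrite gt_max; move: t01 t001 => /andP[_ ->] /andP[_ ->].
have sub x : a <= x <= b -> 0 < x < 1.
  by move=> /andP[ax xb]; rewrite (lt_le_trans a0)//= (le_lt_trans xb).
have wc (k : R -> R) : (forall t, 0 < t < 1 -> {for t, continuous k}) ->
    {within `[a, b], continuous k}.
  move=> ck; apply: continuous_in_subspaceT => x; rewrite inE/= in_itv/= => xab.
  exact/ck/sub.
have [M1 M10 H1] := bounded_on_segment ab (wc _ c11).
have [M2 M20 H2] := bounded_on_segment ab (wc _ c12).
have [M3 M30 H3] := bounded_on_segment ab (wc _ c21).
have [M4 M40 H4] := bounded_on_segment ab (wc _ c22).
pose M := 2 + 2 * (M1 + M2 + M3 + M4).
pose E x := f x * f x + f1 x * f1 x + g x * g x + g1 x * g1 x.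
pose dE x := 2 * (f x * f1 x + f1 x * (a11 x * f x + a12 x * g x) +
  g x * g1 x + g1 x * (a21 x * f x + a22 x * g x)).
have dEP x : a <= x <= b -> is_derive x 1 E (dE x).
  move=> /sub xab.
  have D1 := is_derive1M (df _ xab) (df _ xab).
  have D2 := is_derive1M (df1 _ xab) (df1 _ xab).
  have D3 := is_derive1M (dg _ xab) (dg _ xab).
  have D4 := is_derive1M (dg1 _ xab) (dg1 _ xab).
  have D := is_derive1D (is_derive1D (is_derive1D D1 D2) D3) D4.
  move: D; congr (is_derive x 1 _ _).
  by rewrite /dE; ring.
have E0 x : 0 <= E x by rewrite /E -!expr2; rewrite !addr_ge0// sqr_ge0.
have dEb x : a <= x <= b -> `|dE x| <= M * E x.
  move=> xab; have {}H1 := H1 _ xab; have {}H2 := H2 _ xab.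
  have {}H3 := H3 _ xab; have {}H4 := H4 _ xab.
  have mulb (u v k K : R) : 0 <= K -> `|k| <= K ->
      `|2 * (k * (u * v))| <= K * (u * u + v * v).
    move=> K0 kK; rewrite mulrCA normrM ler_pM//.
    have := sqr_ge0 (u - v); have := sqr_ge0 (u + v); rewrite !expr2 => p q.
    by rewrite ler_norml; apply/andP; split; nra.
  have mulE (u v k K : R) : 0 <= K -> `|k| <= K -> u * u + v * v <= E x ->
      `|2 * (k * (u * v))| <= K * E x.
    by move=> K0 kK uv; rewrite (le_trans (mulb _ _ _ _ K0 kK))// ler_wpM2l.
  have sE (u v p q : R) : u * u + v * v <= u * u + v * v + p * p + q * q.
    by rewrite -addrA lerDl addr_ge0// -expr2 sqr_ge0.
  have L1 : `|2 * (1 * (f x * f1 x))| <= 1 * E x.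
    by apply: mulE; rewrite ?normr1//; exact: sE.
  have L2 : `|2 * (1 * (g x * g1 x))| <= 1 * E x.
    by apply: mulE; rewrite ?normr1// /E; have := sE (g x) (g1 x) (f x) (f1 x); lra.
  have L3 : `|2 * (a11 x * (f1 x * f x))| <= M1 * E x.
    by apply: mulE; rewrite // /E; have := sE (f x) (f1 x) (g x) (g1 x); lra.
  have L4 : `|2 * (a12 x * (f1 x * g x))| <= M2 * E x.
    by apply: mulE; rewrite // /E; have := sE (f1 x) (g x) (f x) (g1 x); lra.
  have L5 : `|2 * (a21 x * (g1 x * f x))| <= M3 * E x.
    by apply: mulE; rewrite // /E; have := sE (f x) (g1 x) (g x) (f1 x); lra.
  have L6 : `|2 * (a22 x * (g1 x * g x))| <= M4 * E x.
    by apply: mulE; rewrite // /E; have := sE (g x) (g1 x) (f x) (f1 x); lra.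
  have ME : M * E x = 1 * E x + 1 * E x + M1 * E x + M2 * E x + M3 * E x + M4 * E x
    + (M1 + M2 + M3 + M4) * E x by rewrite /M; ring.
  have S0 : 0 <= (M1 + M2 + M3 + M4) * E x by rewrite mulr_ge0// !addr_ge0.
  have dEx : dE x = 2 * (1 * (f x * f1 x)) + 2 * (1 * (g x * g1 x)) +
    2 * (a11 x * (f1 x * f x)) + 2 * (a12 x * (f1 x * g x)) +
    2 * (a21 x * (g1 x * f x)) + 2 * (a22 x * (g1 x * g x)) by rewrite /dE; ring.
  rewrite dEx ME.
  do 5 (apply: le_trans (ler_normD _ _) _; rewrite -?lerBrDr).
  lra.
have Et0 : E t0 = 0 by rewrite /E f0 f10 g0 g10; ring.
have decay (s : R) : `|s| = 1 -> forall x y, a <= x -> x <= y -> y <= b ->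
   s * (E y * expR (- s * M * y)) <= s * (E x * expR (- s * M * x)).
  move=> s1 x y ax xy yb.
  pose k z := s * (E z * expR (0 + (- s * M) * z)).
  pose dk z := s * (dE z * expR (0 + (- s * M) * z) +
    E z * (expR (0 + (- s * M) * z) * (- s * M))).
  have dkP z : a <= z <= b -> is_derive z 1 k (dk z).
    move=> zab; have D1 := dEP _ zab.
    have D2 : is_derive z 1 (expR \o (fun z => 0 + (- s * M) * z))
        (expR (0 + (- s * M) * z) * (- s * M)).
      by apply: is_derive1_comp; exact: is_derive1_affine.
    have D3 := is_derive1M (is_derive_cst s z 1) (is_derive1M D1 D2).
    by move: D3; congr (is_derive z 1 _ _); rewrite /dk/=; ring.
  have dk0 z : a <= z <= b -> dk z <= 0.
    move=> zab; have ss : s * s = 1.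
      by rewrite -expr2 -real_normK ?s1 ?expr1n// num_real.
    rewrite /dk; set e := expR _.
    have -> : s * (dE z * e + E z * (e * (- s * M))) = (s * dE z - s * s * (M * E z)) * e.
      by ring.
    rewrite ss mul1r mulr_le0_ge0 ?expR_ge0// subr_le0.
    by rewrite (le_trans (ler_norm _))// normrM s1 mul1r dEb.
  have zz z : a <= z <= b -> z \in `[a, b] by rewrite in_itv.
  suff : k y <= k x by rewrite /k !add0r.
  have cdk : {within `[a, b], continuous k}.
    apply: continuous_in_subspaceT => z; rewrite inE/= in_itv/= => zab.
    by apply: is_derive1_continuous; exact: dkP.
  apply: (@ler0_derive1_le_cc R k a b) => //.
  - move=> z; rewrite in_itv/= => /andP[az zb].
    by have [|+ _] := dkP z _; rewrite ?ltW.
  - move=> z; rewrite in_itv/= => /andP[az zb].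
    have zab : a <= z <= b by rewrite !ltW.
    by rewrite derive1E; have [_ ->] := dkP z zab; exact: dk0.
  - by rewrite in_itv/= yb (le_trans ax).
  - by rewrite in_itv/= ax (le_trans xy).
have Et : E t = 0.
  apply/eqP; rewrite eq_le E0 andbT.
  case: (leP t t0) => tt0.
    have := @decay (-1) _ t t0; rewrite normrN1 Et0 mul0r mulr0.
    rewrite /a /b (min_idPl tt0) (max_idPr tt0) => /(_ erefl (lexx _) tt0 (lexx _)).
    by rewrite mulN1r oppr_ge0 pmulr_lle0 ?expR_gt0.
  have := @decay 1 _ t0 t; rewrite normr1 Et0 mul0r mulr0.
  rewrite /a /b (min_idPr (ltW tt0)) (max_idPl (ltW tt0)).
  move=> /(_ erefl (lexx _) (ltW tt0) (lexx _)).
  by rewrite mul1r pmulr_lle0 ?expR_gt0.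
move: Et; rewrite /E -!expr2 => Et.
have := sqr_ge0 (f t); have := sqr_ge0 (f1 t).
have := sqr_ge0 (g t); have := sqr_ge0 (g1 t).
move=> h1 h2 h3 h4.
have f2 : f t ^+ 2 = 0 by lra.
have g2 : g t ^+ 2 = 0 by lra.
by split; apply/eqP; rewrite -sqrf_eq0 ?f2 ?g2.
Qed.

(** At the zero [c] the second difference of [|f|] is [|f (c + h)| + |f (c - h)|]. Differentiability
    makes it of order [|l| * h], the hypothesis on [|f|] of order [h ^+ 2]. *)
Lemma norm_schwarz_derive_kink f c l m : is_derive c 1 f l -> f c = 0 ->
  schwarz_derive (fun x => `|f x|) c m -> l = 0.
Proof.
move=> df fc sf; apply/eqP; rewrite -normr_le0; apply/ler_addgt0Pl => e e0.
rewrite addr0.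
have e2 : 0 < e / 2 by rewrite divr_gt0.
have [d d0 H] := is_derive1_dist df e2.
have [d1 d10 K] := sf 1 ltr01.
pose C := 1 + `|m|.
have C0 : 0 < C by rewrite ltr_pwDl.
pose h := Num.min (Num.min d d1) (e / 2 / C) / 2.
have h00 : 0 < Num.min (Num.min d d1) (e / 2 / C).
  by rewrite !lt_min d0 d10 divr_gt0.
have h0 : 0 < h by rewrite divr_gt0.
have : h < Num.min (Num.min d d1) (e / 2 / C) by rewrite /h; lra.
rewrite !lt_min => /andP[/andP[hd hd1]].
rewrite ltr_pdivlMr// => hC.
have {}K : `|f (c + h)| <= C * h ^+ 2.
  have := K h; rewrite h0 hd1 => /(_ isT).
  rewrite /diff2 fc normr0 mulr0 subr0 ler_norml => /andP[_ K'].
  have : 0 <= `|f (c - h)| by [].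
  have : h ^+ 2 * m <= h ^+ 2 * `|m| by rewrite ler_wpM2l ?sqr_ge0// ler_norm.
  rewrite /C; nra.
have := H (c + h); rewrite (_ : c + h - c = h); last by ring.
rewrite (gtr0_norm h0) fc subr0 => /(_ hd) L.
rewrite -(ler_pM2r h0) -{1}(gtr0_norm h0) -normrM.
have -> : l * h = f (c + h) - (f (c + h) - l * h) by ring.
rewrite (le_trans (ler_normB _ _))//.
have : C * h ^+ 2 <= e / 2 * h by rewrite expr2 mulrA ler_wpM2r// ?(ltW h0)// mulrC ltW.
have : e / 2 * h + e / 2 * h = e * h by field.
lra.
Qed.

(** The factor [s] carries the common sign of [f] on both sides of [c], so that strict minima and
    maxima are treated at once. *)
Definition isolated_touching_zero f c : Prop :=
  exists2 d, 0 < d & exists2 s, s != 0 &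
    forall x, 0 < `|x - c| -> `|x - c| < d -> 0 < s * f x.

(** Second derivative test with [s = l]: near [c] the derivative [f1] has the sign of [l * (x - c)],
    and the mean value theorem between [x] and [c] hands this on to [f]. *)
Lemma touching_zero f f1 c l : 0 < c < 1 ->
  (forall t, 0 < t < 1 -> is_derive t 1 f (f1 t)) ->
  is_derive c 1 f1 l -> f c = 0 -> f1 c = 0 -> l != 0 ->
  isolated_touching_zero f c.
Proof.
move=> c01 df df1 fc f1c l0.
have e0 : 0 < `|l| / 2 by rewrite divr_gt0// normr_gt0.
have [d d0 H] := is_derive1_dist df1 e0.
have m0 : 0 < Num.min d (Num.min c (1 - c)).
  by rewrite !lt_min d0 subr_gt0; move: c01 => /andP[-> ->].
have ll : 0 < l * l by rewrite -expr2 exprn_even_gt0.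
have sgn x : `|x - c| < Num.min d (Num.min c (1 - c)) -> x != c ->
    0 < l * f1 x * (x - c).
  move=> xd xc; have {}H : `|f1 x - l * (x - c)| <= `|l| / 2 * `|x - c|.
    have := H x; rewrite f1c subr0; apply.
    by move: xd; rewrite lt_min => /andP[].
  have K : `|l * f1 x * (x - c) - l * l * ((x - c) * (x - c))| <=
     l * l * ((x - c) * (x - c)) / 2.
    have -> : l * f1 x * (x - c) - l * l * ((x - c) * (x - c)) =
      l * (x - c) * (f1 x - l * (x - c)) by ring.
    rewrite normrM (le_trans (ler_wpM2l _ H))// normrM.
    have -> : `|l| * `|x - c| * (`|l| / 2 * `|x - c|) =
      (`|l| * `|l|) * (`|x - c| * `|x - c|) / 2 by ring.
    by rewrite -!expr2 !real_normK ?num_real.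
  have : 0 < l * l * ((x - c) * (x - c)).
    by rewrite mulr_gt0// -expr2 exprn_even_gt0// subr_eq0.
  move: K; rewrite ler_norml => /andP[]; lra.
exists (Num.min d (Num.min c (1 - c))) => //; exists l => // x xc0 xd.
have xc : x != c by rewrite -subr_eq0 -normr_gt0.
have cx01 y : `|y - c| < Num.min d (Num.min c (1 - c)) -> 0 < y < 1.
  rewrite !lt_min !ltr_norml => /andP[_ /andP[/andP[? ?] /andP[? ?]]].
  by apply/andP; split; lra.
have mvt u v : u < v -> (forall y, u <= y <= v -> 0 < y < 1) ->
    exists2 z, u < z < v & f v - f u = f1 z * (v - u).
  move=> uv uvs; have [||z] := @MVT R f f1 u v uv.
  - move=> y; rewrite in_itv/= => /andP[uy yv].
    by apply: df; apply: uvs; rewrite !ltW.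
  - apply: continuous_in_subspaceT => y; rewrite inE/= in_itv/= => yab.
    by apply: is_derive1_continuous; apply: df; exact: uvs.
  by rewrite in_itv/= => zuv ->; exists z.
case: (ltgtP x c) => [xlc|clx|/eqP]; last by rewrite (negbTE xc).
- have [y /andP[xy yc]|z /andP[xz zc]] := mvt x c xlc.
    by apply: cx01; rewrite (le_lt_trans _ xd)// !ler0_norm ?subr_le0 ?(ltW xlc)//; lra.
  rewrite fc sub0r => fx.
  have zd : `|z - c| < `|x - c|.
    by rewrite !ltr0_norm ?subr_lt0//; lra.
  have := sgn z (lt_trans zd xd); rewrite lt_eqF// => /(_ isT) Z.
  have -> : f x = - (f1 z * (c - x)) by rewrite -fx opprK.
  have : 0 < - (l * f1 z).
    by move: Z; rewrite -mulrNN pmulr_lgt0// oppr_gt0 subr_lt0.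
  have -> : l * - (f1 z * (c - x)) = - (l * f1 z) * (c - x) by ring.
  by move=> ?; rewrite mulr_gt0// subr_gt0.
- have [y /andP[cy yx]|z /andP[cz zx]] := mvt c x clx.
    by apply: cx01; rewrite (le_lt_trans _ xd)// !ger0_norm ?subr_ge0 ?(ltW clx)//; lra.
  rewrite fc subr0 => ->.
  have zd : `|z - c| < `|x - c|.
    by rewrite !gtr0_norm ?subr_gt0//; lra.
  have := sgn z (lt_trans zd xd); rewrite gt_eqF// => /(_ isT) Z.
  have : 0 < l * f1 z by move: Z; rewrite pmulr_lgt0// subr_gt0.
  by rewrite mulrA => ?; rewrite mulr_gt0// subr_gt0.
Qed.

(** Let [c] be the supremum of the times up to which [f] stays nonnegative after [u]. By continuity
    [f c] is neither negative nor positive; if it is zero, nonnegativity on the left makes [s]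
    positive, so [f] is positive just after [c] too, against the choice of [c]. *)
Lemma constant_sign_oo f :
  (forall t, 0 < t < 1 -> {for t, continuous f}) ->
  (forall c, 0 < c < 1 -> f c = 0 -> isolated_touching_zero f c) ->
  forall u v, 0 < u -> u < v -> v < 1 -> 0 < f u -> 0 <= f v.
Proof.
move=> cf zf u v u0 uv v1 fu; rewrite leNgt; apply/negP => fv.
pose A := [set t | u <= t <= v /\ forall x, u <= x <= t -> 0 <= f x].
have uA : A u.
  split; first by rewrite lexx ltW.
  by move=> x /le_anti <-; exact: ltW.
have ubA : has_sup A.
  by split; [exists u | exists v => t [/andP[]]].
pose c := sup A.
have uc : u <= c by apply: sup_upper_bound.
have cv : c <= v by apply: ge_sup; [exists u|move=> t [/andP[]]].
have c01 : 0 < c < 1 by rewrite (lt_le_trans u0)//= (le_lt_trans cv).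
have below x : u <= x -> x < c -> 0 <= f x.
  move=> ux xc; have cx0 : 0 < c - x by rewrite subr_gt0.
  have [y [yuv yP]] := sup_adherent cx0 ubA; rewrite subKr => xy.
  by apply: yP; rewrite ux ltW.
have := cf c c01; rewrite /continuous_at => cfc.
have [fc0|fc0|fc0] := ltgtP (f c) 0.
- have [d /= d0 dP] : \forall x \near c, f x < 0 by apply: cvgr_lt cfc _ _.
  have uc' : u < c.
    by rewrite lt_neqAle uc andbT; apply/eqP => e; move: fc0; rewrite -e ltNge ltW.
  pose x := Num.max u (c - d / 2).
  have xc : x < c by rewrite gt_max uc'/=; lra.
  have ux : u <= x by rewrite le_max lexx.
  have := below x ux xc; rewrite leNgt dP//=.
  rewrite gtr0_norm ?subr_gt0//.
  have : c - d / 2 <= x by rewrite le_max lexx orbT.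
  by lra.
- have [d /= d0 dP] : \forall x \near c, 0 < f x by apply: cvgr_gt cfc _ _.
  have cv' : c < v.
    by rewrite lt_neqAle cv andbT; apply/eqP => e; move: fc0; rewrite e ltNge ltW.
  pose y := Num.min v (c + d / 2).
  have cy : c < y by rewrite lt_min cv'/=; lra.
  have : A y.
    split.
      by rewrite ge_min lexx (ltW (le_lt_trans uc cy)).
    move=> x /andP[ux xy]; case: (ltP x c) => xc; first exact: below.
    apply/ltW/dP => /=; rewrite ler0_norm ?subr_le0// opprB.
    have : y <= c + d / 2 by rewrite ge_min lexx orbT.
    by lra.
  by move/(sup_upper_bound ubA); rewrite leNgt cy.
- have uc' : u < c.
    by rewrite lt_neqAle uc andbT; apply/eqP => e; move: fu; rewrite e fc0 ltxx.
  have cv' : c < v.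
    by rewrite lt_neqAle cv andbT; apply/eqP => e; move: fv; rewrite -e fc0 ltxx.
  have [d d0 [s s0 H]] := zf c c01 fc0.
  (* The sign of [s] is read off at a point slightly to the left of [c], where [f] is known to be
     nonnegative. *)
  have sp : 0 < s.
    pose x := Num.max u (c - d / 2).
    have xc : x < c by rewrite gt_max uc'/=; lra.
    have ux : u <= x by rewrite le_max lexx.
    have xd : c - d / 2 <= x by rewrite le_max lexx orbT.
    have := H x; rewrite ltr0_norm ?subr_lt0// opprB subr_gt0 => /(_ xc).
    have -> : c - x < d by lra.
    move=> /(_ isT); rewrite ltNge => sf; rewrite ltNge; apply: contra sf => sle.
    by rewrite mulr_le0_ge0//; exact: below.
  pose y := Num.min v (c + d / 2).
  have cy : c < y by rewrite lt_min cv'/=; lra.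
  have : A y.
    split.
      by rewrite ge_min lexx (ltW (le_lt_trans uc cy)).
    move=> x /andP[ux xy]; case: (ltgtP x c) => xc; [exact: below| |by rewrite xc fc0].
    have := H x; rewrite gtr0_norm ?subr_gt0// => /(_ xc).
    have yd : y <= c + d / 2 by rewrite ge_min lexx orbT.
    have -> : x - c < d by lra.
    by move=> /(_ isT); rewrite pmulr_rgt0// => /ltW.
  by move/(sup_upper_bound ubA); rewrite leNgt cy.
Qed.

Lemma isolated_touching_zeroN f c :
  isolated_touching_zero f c -> isolated_touching_zero (fun x => - f x) c.
Proof.
move=> [d d0 [s s0 H]]; exists d => //; exists (- s); first by rewrite oppr_eq0.
by move=> x x1 x2; rewrite mulrNN; exact: H.
Qed.

Lemma constant_sign f : {within `[0, 1], continuous f} ->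
  (forall c, 0 < c < 1 -> f c = 0 -> isolated_touching_zero f c) ->
  (forall t, 0 <= t <= 1 -> 0 <= f t) \/ (forall t, 0 <= t <= 1 -> f t <= 0).
Proof.
move=> cf zf.
have [cf1 cf0 cf2] := (continuous_within_itvP _ ltr01).1 cf.
have coo t : 0 < t < 1 -> {for t, continuous f}.
  by move=> t01; apply: cf1; rewrite in_itv.
have coN t : 0 < t < 1 -> {for t, continuous (fun x => - f x)}.
  by move=> t01; apply: cvgN; exact: coo.
have zN c : 0 < c < 1 -> - f c = 0 -> isolated_touching_zero (fun x => - f x) c.
  move=> c01 /eqP; rewrite oppr_eq0 => /eqP fc.
  exact/isolated_touching_zeroN/zf.
have [[u [u01 fu]]|nu] := pselect (exists u, 0 < u < 1 /\ 0 < f u); last first.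
  right => t; have H : forall x, 0 < x < 1 -> f x <= 0.
    by move=> x x01; rewrite leNgt; apply/negP => fx; apply: nu; exists x.
  move=> /andP[]; rewrite le_eqVlt => /predU1P[<- _|t0].
    apply: (closed_cvg _ (@closed_le _ 0) _ _ cf0); near=> x; apply: H.
    by apply/andP; split; near: x; [exact: nbhs_right_gt|exact: nbhs_right_lt].
  rewrite le_eqVlt => /predU1P[->|t1]; last by apply: H; rewrite t0.
  apply: (closed_cvg _ (@closed_le _ 0) _ _ cf2); near=> x; apply: H.
  by apply/andP; split; near: x; [exact: nbhs_left_gt|exact: nbhs_left_lt].
left => t.
have H x : 0 < x < 1 -> 0 <= f x.
  move: u01 => /andP[u0 u1] /andP[x0 x1]; case: (ltgtP u x) => [ux|xu|<-].
  - exact: (constant_sign_oo coo zf u0 ux x1 fu).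
  - rewrite leNgt -oppr_gt0; apply/negP => fx.
    have := constant_sign_oo coN zN x0 xu u1 fx.
    by rewrite oppr_ge0 leNgt fu.
  - exact: ltW.
move=> /andP[]; rewrite le_eqVlt => /predU1P[<- _|t0].
  apply: (closed_cvg _ (@closed_ge _ 0) _ _ cf0); near=> x; apply: H.
  by apply/andP; split; near: x; [exact: nbhs_right_gt|exact: nbhs_right_lt].
rewrite le_eqVlt => /predU1P[->|t1]; last by apply: H; rewrite t0.
apply: (closed_cvg _ (@closed_ge _ 0) _ _ cf2); near=> x; apply: H.
by apply/andP; split; near: x; [exact: nbhs_left_gt|exact: nbhs_left_lt].
Unshelve. all: by end_near. Qed.

(** Since zeros are isolated, [f] has none immediately to the right of the midpoint. Iterated over
    the four coordinates, this provides a time at which none of them vanishes. *)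
Lemma nonzero_subinterval f :
  (forall t, 0 < t < 1 -> {for t, continuous f}) ->
  (forall c, 0 < c < 1 -> f c = 0 -> isolated_touching_zero f c) ->
  forall a b, 0 < a -> a < b -> b < 1 -> exists a' b',
    [/\ a < a', a' < b', b' < b & forall x, a' <= x <= b' -> f x != 0].
Proof.
move=> cf zf a b a0 ab b1; pose c := (a + b) / 2.
have c01 : 0 < c < 1 by rewrite /c; apply/andP; split; lra.
have [d d0 H] : exists2 d, 0 < d & forall x, c < x -> x < c + d -> f x != 0.
  have [fc|fc] := eqVneq (f c) 0.
    have [d d0 [s s0 H]] := zf c c01 fc.
    exists d => // x cx xd; have := H x; rewrite gtr0_norm ?subr_gt0// => /(_ cx).
    rewrite ltrBlDl => /(_ xd); apply: contraTneq => ->.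
    by rewrite mulr0 ltxx.
  have := cf c c01; rewrite /continuous_at => cfc.
  have [d /= d0 dP] : \forall x \near c, f x != 0 by exact: cvgr_neq0 cfc _.
  exists d => // x cx xd; apply: dP => /=.
  by rewrite ltr0_norm ?subr_lt0// opprB ltrBlDl.
pose e := Num.min d (b - c).
have cb : c < b by rewrite /c; lra.
have ac : a < c by rewrite /c; lra.
have e0 : 0 < e by rewrite lt_min d0 subr_gt0.
have ed : e <= d by rewrite ge_min lexx.
have eb : e <= b - c by rewrite ge_min lexx orbT.
(* The middle third of the zero-free interval keeps every inequality strict. *)
exists (c + e / 3), (c + 2 * e / 3); split; [lra..|].
by move=> x /andP[x1 x2]; apply: H; lra.
Qed.

Lemma cvg_within01_eq f (l : R) : {within `[0, 1], continuous f} ->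
  (forall t, 0 < t < 1 -> f t = l) -> forall t, 0 <= t <= 1 -> f t = l.
Proof.
move=> cf fl t.
have [cf1 cf0 cf2] := (continuous_within_itvP _ ltr01).1 cf.
move=> /andP[]; rewrite le_eqVlt => /predU1P[<- _|t0].
  apply: (closed_cvg _ (@closed_eq _ l) _ _ cf0); near=> x; apply: fl.
  by apply/andP; split; near: x; [exact: nbhs_right_gt|exact: nbhs_right_lt].
rewrite le_eqVlt => /predU1P[->|t1]; last by apply: fl; rewrite t0.
apply: (closed_cvg _ (@closed_eq _ l) _ _ cf2); near=> x; apply: fl.
by apply/andP; split; near: x; [exact: nbhs_left_gt|exact: nbhs_left_lt].
Unshelve. all: by end_near. Qed.

End Zeros.

(** * H^1 functions on the unit interval *)

Section SobolevInterval.
Variable R : realType.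
Implicit Types (f g G w W : R -> R) (a b c d h t x l m eta : R).
Local Notation mu := (@lebesgue_measure R).
Local Notation I01 := `[(0:R), (1:R)]%classic.

Definition is_H1 f g : Prop :=
  [/\ measurable_fun I01 g,
      (\int[mu]_(s in I01) (g s ^+ 2)%:E < +oo)%E &
      forall t, 0 <= t <= 1 -> f t = f 0 + \int[mu]_(s in `[0, t]) g s].

Lemma measure_I01 : (mu I01 < +oo)%E.
Proof. by rewrite lebesgue_measure_itv/= lte_fin ltr01 sube0 ltry. Qed.

Lemma ge0_integrable_I01 g : measurable_fun I01 g -> (forall s, 0 <= g s) ->
  (\int[mu]_(s in I01) (g s)%:E < +oo)%E -> mu.-integrable I01 (EFin \o g).
Proof.
move=> mg g0 ig; apply/integrableP; split; first exact/measurable_EFinP.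
rewrite (le_lt_trans _ ig)// le_eqVlt; apply/orP; left; apply/eqP.
by apply: eq_integral => s _ /=; rewrite ger0_norm.
Qed.

Lemma integrable_dominated (D : set R) g (h : R -> R) : measurable D ->
  measurable_fun D g -> (forall s, D s -> `|g s| <= `|h s|) ->
  mu.-integrable D (EFin \o h) -> mu.-integrable D (EFin \o g).
Proof.
by move=> mD mg gh; apply: le_integrable => //; exact/measurable_EFinP.
Qed.

Lemma is_H1_sqr_integrable f g : is_H1 f g ->
  mu.-integrable I01 (EFin \o (fun s => g s ^+ 2)).
Proof.
move=> [mg ig _]; apply: ge0_integrable_I01 => //.
- exact: measurable_funX.
- by move=> s; rewrite sqr_ge0.
Qed.

Lemma integrable_cst_I01 (k : R) : mu.-integrable I01 (EFin \o (fun=> k)).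
Proof.
apply: continuous_compact_integrable; first exact: segment_compact.
by apply: continuous_subspaceT; exact: cst_continuous.
Qed.

Lemma integrableD_EFin (D : set R) g (h : R -> R) : measurable D ->
  mu.-integrable D (EFin \o g) -> mu.-integrable D (EFin \o h) ->
  mu.-integrable D (EFin \o (fun s => g s + h s)).
Proof.
move=> mD ig ih.
rewrite (_ : EFin \o _ = ((EFin \o g) \+ (EFin \o h))%E); last first.
  by apply/funext => s /=; rewrite EFinD.
exact: integrableD.
Qed.

Lemma integrableZ_EFin (D : set R) (k : R) g : measurable D ->
  mu.-integrable D (EFin \o g) ->
  mu.-integrable D (EFin \o (fun s => k * g s)).
Proof.
move=> mD ig.
rewrite (_ : EFin \o _ = (fun s => k%:E * (EFin \o g) s)%E); last first.
  by apply/funext => s /=; rewrite EFinM.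
exact: integrableZl.
Qed.

(** On a set of finite measure L^2 lies in L^1, here through [|g| <= 1 + g ^+ 2]. *)
Lemma is_H1_integrable f g : is_H1 f g -> mu.-integrable I01 (EFin \o g).
Proof.
move=> fg; have [mg _ _] := fg.
have := integrableD_EFin (measurable_itv _) (integrable_cst_I01 1) (is_H1_sqr_integrable fg).
apply: integrable_dominated => // s _.
rewrite [leRHS]ger0_norm; last by rewrite addr_ge0// sqr_ge0.
have := sqr_ge0 (`|g s| - 1); rewrite -[g s ^+ 2]real_normK ?num_real//.
move: `|g s| => u; nra.
Qed.

Lemma subset_I01 a b : 0 <= a -> b <= 1 -> `[a, b] `<=` I01.
Proof. by move=> a0 b1; apply: subset_itvScc; rewrite bnd_simp. Qed.

Lemma is_H1_within_continuous f g : is_H1 f g -> {within I01, continuous f}.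
Proof.
move=> fg; have ig := is_H1_integrable fg; have [_ _ fE] := fg.
have c := parameterized_integral_continuous ler01 ig.
apply: (@subspace_eq_continuous _ _ _ (fun t => f 0 + \int[mu]_(s in `[0, t]) g s)).
  by move=> t; rewrite inE/= in_itv/= => t01; rewrite /from_subspace (fE t).
by move=> t; apply: cvgD; [exact: cvg_cst|exact: c].
Qed.

Lemma is_H1_continuous f g t : is_H1 f g -> 0 < t < 1 -> {for t, continuous f}.
Proof.
move=> /is_H1_within_continuous /(continuous_within_itvP _ ltr01)[c _ _] t01.
by apply: c; rewrite in_itv.
Qed.

Lemma is_H1_measurable f g : is_H1 f g -> measurable_fun I01 f.
Proof.
move=> /is_H1_within_continuous; apply: subspace_continuous_measurable_fun.
exact: measurable_itv.
Qed.

Lemma is_H1_integral f g a b : is_H1 f g -> 0 <= a -> a <= b -> b <= 1 ->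
  \int[mu]_(s in `]a, b]) g s = f b - f a.
Proof.
move=> fg a0 ab b1; have ig := is_H1_integrable fg; have [_ _ fE] := fg.
rewrite (fE b) ?b1 ?(le_trans a0)// (fE a) ?a0 ?(le_trans ab)//.
rewrite opprD addrACA subrr add0r Rintegral_itvB ?bnd_simp//.
by apply: integrableS ig => //; exact: subset_I01.
Qed.

Lemma is_H1D f g f' g' : is_H1 f g -> is_H1 f' g' ->
  is_H1 (fun t => f t + f' t) (fun t => g t + g' t).
Proof.
move=> fg fg'; have ig := is_H1_integrable fg; have ig' := is_H1_integrable fg'.
have is2 := is_H1_sqr_integrable fg; have is2' := is_H1_sqr_integrable fg'.
have [mg _ fE] := fg; have [mg' _ fE'] := fg'; split.
- exact: measurable_funD.
- have := integrableZ_EFin 2 (measurable_itv _) (integrableD_EFin (measurable_itv _) is2 is2').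
  move=> /integrableP[+ +]; move=> /measurable_EFinP m2.
  apply: le_lt_trans; apply: ge0_le_integral => //.
  + by move=> s _; rewrite lee_fin sqr_ge0.
  + by apply/measurable_EFinP; apply: measurable_funX; exact: measurable_funD.
  + by do 2 apply: measurableT_comp => //.
  + move=> s _ /=; rewrite lee_fin ger0_norm.
      by have := sqr_ge0 (g s - g' s); nra.
    by rewrite mulr_ge0// addr_ge0// sqr_ge0.
- move=> t t01; have st : `[0, t] `<=` I01.
    by apply: subset_I01 => //; case/andP : t01.
  rewrite fE// fE'// RintegralD//; [by ring|exact: integrableS ig|].
  exact: integrableS ig'.
Qed.

Lemma is_H1Z f g (k : R) : is_H1 f g -> is_H1 (fun t => k * f t) (fun t => k * g t).
Proof.
move=> fg; have ig := is_H1_integrable fg.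
have is2 := is_H1_sqr_integrable fg.
have [mg _ fE] := fg; split.
- exact: measurable_funM.
- have := integrableZ_EFin (k ^+ 2) (measurable_itv _) is2.
  move=> /integrableP[+ +]; move=> /measurable_EFinP m2.
  apply: le_lt_trans; rewrite le_eqVlt; apply/orP; left; apply/eqP.
  apply: eq_integral => s _ /=; rewrite ger0_norm ?exprMn//.
  by rewrite mulr_ge0// sqr_ge0.
- move=> t t01; have st : `[0, t] `<=` I01.
    by apply: subset_I01 => //; case/andP : t01.
  by rewrite fE// RintegralZl// ?mulrDr//; exact: integrableS ig.
Qed.

Lemma is_H1_C1 f g : (forall x, is_derive x 1 f (g x)) -> continuous g -> is_H1 f g.
Proof.
move=> df cg.
have cg2 : continuous (fun s => g s ^+ 2).
  by move=> s; apply: (@continuous_comp _ _ _ g (fun y : R => y ^+ 2));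
    [exact: cg|exact: exprn_continuous].
have mg : measurable_fun setT g by exact: continuous_measurable_fun.
split.
- exact: measurable_funTS.
- have : mu.-integrable I01 (EFin \o (fun s => g s ^+ 2)).
    apply: continuous_compact_integrable; first exact: segment_compact.
    exact: continuous_subspaceT.
  move=> /integrableP[_]; apply: le_lt_trans.
  rewrite le_eqVlt; apply/orP; left; apply/eqP.
  by apply: eq_integral => s _ /=; rewrite ger0_norm// sqr_ge0.
- move=> t /andP[]; rewrite le_eqVlt => /predU1P[<- _|t0 t1].
    by rewrite set_itv1 Rintegral_set1 addr0.
  rewrite /Rintegral (@continuous_FTC2 _ g f)//.
  + by rewrite -EFinB/=; ring.
  + exact: continuous_subspaceT.
  + split.
    * by move=> x _; case: (df x).
    * apply: cvg_at_right_filter; exact: is_derive1_continuous.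
    * apply: cvg_at_left_filter; exact: is_derive1_continuous.
  + by move=> x _; rewrite derive1E; case: (df x).
Qed.

Lemma is_H1_cst (k : R) : is_H1 (fun=> k) (fun=> 0).
Proof.
by apply: is_H1_C1; exact: cst_continuous.
Qed.

(** The Heaviside function at [a], with primitive [ramp a]; tents are combinations of three ramps.
    Integrating [step a] against a weak derivative returns an increment of the function, which is
    how second differences come out of the action. *)
Definition step a t : R := if a < t then 1 else 0.
Definition ramp a t : R := if a < t then t - a else 0.

Lemma integral_step f g a t : is_H1 f g -> 0 <= a <= 1 -> 0 <= t <= 1 ->
  \int[mu]_(s in `[0, t]) (step a s * g s) = if a < t then f t - f a else 0.
Proof.
move=> fg /andP[a0 a1] /andP[t0 t1].
have -> : \int[mu]_(s in `[0, t]) (step a s * g s) =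
    \int[mu]_(s in `[0, t] `&` `]a, +oo[) g s.
  rewrite Rintegral_mkcondr; apply: eq_Rintegral => s _; rewrite patchE /step.
  case: ifPn => as_; first by rewrite mul1r mem_set//= in_itv/= andbT.
  by rewrite mul0r memNset//= in_itv/= andbT; exact/negP.
case: ifPn => [at_|ta].
  rewrite -(is_H1_integral fg) ?(ltW at_)//; congr (Rintegral _ _ _).
  apply/seteqP; split => s /=; rewrite !in_itv/= andbT.
    by move=> [/andP[_ ->] ->].
  by move=> /andP[as_ ->]; rewrite (le_trans a0 (ltW as_)).
rewrite (_ : _ `&` _ = set0) ?Rintegral_set0//.
apply/seteqP; split => // s /=; rewrite !in_itv/= andbT => -[/andP[_ st] as_].
by move: ta; rewrite (lt_le_trans as_ st).
Qed.

Lemma measurable_step a (D : set R) : measurable_fun D (step a).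
Proof.
apply: measurable_funTS; apply: measurable_fun_ifT => //.
exact: measurable_fun_ltr.
Qed.

Lemma step_norm_le1 a t : `|step a t| <= 1.
Proof. by rewrite /step; case: ifP; rewrite ?normr1 ?normr0. Qed.

Lemma integrable_step f g a : is_H1 f g ->
  mu.-integrable I01 (EFin \o (fun s => step a s * g s)).
Proof.
move=> fg; have [mg _ _] := fg; have := is_H1_integrable fg.
apply: integrable_dominated => //.
  by apply: measurable_funM => //; exact: measurable_step.
by move=> s _; rewrite normrM ler_piMl// step_norm_le1.
Qed.

Lemma is_H1_ramp a : 0 <= a <= 1 -> is_H1 (ramp a) (step a).
Proof.
move=> a01; have id_H1 : is_H1 (fun t => t) (fun=> 1).
  by apply: is_H1_C1; exact: cst_continuous.
split.
- exact: measurable_step.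
- apply: le_lt_trans (measure_I01); rewrite -[leRHS]mul1e -integral_cst//.
  apply: ge0_le_integral => //.
  + by move=> s _; rewrite lee_fin sqr_ge0.
  + by apply/measurable_EFinP; apply: measurable_funX; exact: measurable_step.
  + by move=> s _; rewrite lee_fin /step; case: ifP; rewrite ?expr1n ?expr0n.
- move=> t t01; rewrite {2}/ramp ltNge; move: (a01) => /andP[-> _] /=; rewrite add0r.
  rewrite /ramp -(integral_step id_H1)//.
  by apply: eq_Rintegral => s _; rewrite mulr1.
Qed.

Lemma integral_ramp a : 0 <= a <= 1 ->
  \int[mu]_(s in I01) ramp a s = (1 - a) ^+ 2 / 2.
Proof.
move=> a01.
have sq_H1 : is_H1 (fun t => (t - a) * (t - a) / 2) (fun t => t - a).
  apply: is_H1_C1 => x.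
    have D := is_derive1B (is_derive1_id x) (is_derive_cst a x 1).
    have D2 := is_derive1M (is_derive1M D D) (is_derive_cst (2^-1 : R) x 1).
    by move: D2; congr (is_derive x 1 _ _) => /=; field.
  by apply: cvgB; [exact: cvg_id|exact: cvg_cst].
have -> : \int[mu]_(s in I01) ramp a s = \int[mu]_(s in I01) (step a s * (s - a)).
  by apply: eq_Rintegral => s _; rewrite /ramp /step; case: ifP; rewrite ?mul1r ?mul0r.
rewrite (integral_step sq_H1)// ?ler01 ?lexx// subrr mul0r mul0r subr0 expr2.
case: ifPn => //; rewrite -leNgt => a1.
have -> : a = 1 by apply/eqP; rewrite eq_le a1 andbT; case/andP : a01.
by rewrite subrr !mul0r.
Qed.

Lemma integrable_ramp a : 0 <= a <= 1 -> mu.-integrable I01 (EFin \o ramp a).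
Proof.
move=> a01; apply: continuous_compact_integrable; first exact: segment_compact.
exact: is_H1_within_continuous (is_H1_ramp a01).
Qed.

End SobolevInterval.

(** * Absolute values and powers in H^1 *)

Section AbsoluteValueAndPowers.
Variable R : realType.
Implicit Types (f g G w W : R -> R) (a b c d h t x l m eta : R).
Local Notation mu := (@lebesgue_measure R).
Local Notation I01 := `[(0:R), (1:R)]%classic.

Lemma measurable_sgr : measurable_fun setT (Num.sg : R -> R).
Proof.
rewrite (_ : Num.sg = fun y : R => step 0 y - step 0 (- y)).
  apply: measurable_funB; first exact: measurable_step.
  by apply: measurableT_comp; [exact: measurable_step|exact: oppr_measurable].
apply/funext => y; rewrite /step oppr_gt0; case: sgrP => [|y0|y0].
- by rewrite subrr.
- by rewrite subr0.
- by rewrite sub0r.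
Qed.

(** Lebesgue differentiation. It allows the pointwise derivative to replace the weak one under an
    integral. *)
Lemma is_H1_derive_ae f g : is_H1 f g ->
  {ae mu, forall x, 0 < x < 1 -> derive1 f x = g x}.
Proof.
move=> fg; have ig := is_H1_integrable fg; have [_ _ fE] := fg.
have iT : mu.-integrable setT (EFin \o (g \_ I01)).
  by rewrite -restrict_EFin; apply/integrable_restrict => //=; rewrite setTI.
have iy y : mu.-integrable [set` Interval (BLeft 0) (BRight y)] (EFin \o (g \_ I01)).
  exact: integrableS iT.
have := FTC1 iy (integrable_locally (measurable_itv _) ig).
apply: filterS; first exact: (ae_filter_ringOfSetsType mu).
move=> x H /andP[x0 x1].
have [|dF FE] := H.
  exact: x0.
rewrite patchE mem_set/= ?in_itv/= ?ltW// in FE.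
have D := derivable_is_derive1 dF; rewrite FE in D.
have D2 := is_derive1D D (is_derive_cst (f 0) x 1).
suff [_ ] : is_derive x 1 f (g x + 0) by rewrite addr0 derive1E.
apply: near_eq_is_derive D2.
have : x \in `]0, 1[ by rewrite in_itv/= x0.
move=> /near_in_itvoo; apply: filterS => y; rewrite in_itv/= => /andP[y0 y1].
rewrite (fE y) ?ltW//= addrC; congr (_ + _); apply: eq_Rintegral => s.
rewrite inE/= in_itv/= => /andP[s0 sy].
by rewrite patchE mem_set//= in_itv/= s0 (le_trans sy (ltW y1)).
Qed.

Lemma sqrtr_sqrD_derive f f1 x (e : R) : 0 < e -> is_derive x 1 f (f1 x) ->
  is_derive x 1 (fun y => Num.sqrt (f y ^+ 2 + e)) (f x * f1 x / Num.sqrt (f x ^+ 2 + e)).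
Proof.
move=> e0 df.
have pos : 0 < f x * f x + e by rewrite ltr_wpDl// -expr2 sqr_ge0.
have D1 := is_derive1D (is_derive1M df df) (is_derive_cst e x 1).
have D2 : is_derive x 1 (Num.sqrt \o (fun y => f y * f y + cst e y))
    ((2 * Num.sqrt (f x * f x + e))^-1 * (f1 x * f x + f x * f1 x + 0)).
  by apply: is_derive1_comp; exact: is_derive1_sqrt.
move: D2; congr (is_derive x 1 _ _).
have : Num.sqrt (f x * f x + e) != 0 by rewrite gt_eqF// sqrtr_gt0.
by rewrite expr2 => s0; field.
Qed.

Lemma sqrtr_sqrD_cvg (u : R) :
  Num.sqrt (u ^+ 2 + n.+1%:R^-1) @[n --> \oo] --> `|u|.
Proof.
rewrite -sqrtr_sqr.
apply: continuous_cvg; first exact: sqrt_continuous.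
rewrite -[X in _ --> X]addr0; apply: cvgD; first exact: cvg_cst.
exact: cvg_harmonic.
Qed.

(** Approximate [|f|] by the smooth functions [sqrt (f ^+ 2 + 1/(n+1))], apply the fundamental
    theorem to each, and pass to the limit by dominated convergence with bound [|f1|]. *)
Lemma norm_FTC f f1 a b : a < b ->
  (forall x, a <= x <= b -> is_derive x 1 f (f1 x)) ->
  {within `[a, b], continuous f1} ->
  (\int[mu]_(s in `[a, b]) (Num.sg (f s) * f1 s)%:E = (`|f b| - `|f a|)%:E)%E.
Proof.
move=> ab df cf1.
have cf : {within `[a, b], continuous f}.
  apply: continuous_in_subspaceT => x; rewrite inE/= in_itv/= => xab.
  by apply: is_derive1_continuous; exact: df.
pose k (n : nat) x := f x * f1 x / Num.sqrt (f x ^+ 2 + n.+1%:R^-1).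
have e0 (n : nat) : 0 < n.+1%:R^-1 :> R by rewrite invr_gt0.
have pos n x : 0 < Num.sqrt (f x ^+ 2 + n.+1%:R^-1).
  by rewrite sqrtr_gt0 ltr_wpDl// sqr_ge0.
have cs n : {within `[a, b], continuous (fun x => Num.sqrt (f x ^+ 2 + n.+1%:R^-1))}.
  have c2 : {within `[a, b], continuous (fun x => f x ^+ 2 + n.+1%:R^-1)}.
    by move=> x; apply: cvgD; [exact: (cvgM (cf x) (cf x))|exact: cvg_cst].
  by move=> x; apply: continuous_cvg; [exact: sqrt_continuous|exact: c2].
have ck n : {within `[a, b], continuous (k n)}.
  move=> x; apply: cvgM; first by apply: cvgM; [exact: cf|exact: cf1].
  by apply: cvgV; [rewrite gt_eqF|exact: cs].
have mcont (g : R -> R) : {within `[a, b], continuous g} -> measurable_fun `[a, b] g.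
  by apply: subspace_continuous_measurable_fun; exact: measurable_itv.
have FTC n : (\int[mu]_(s in `[a, b]) (k n s)%:E =
    (Num.sqrt (f b ^+ 2 + n.+1%:R^-1))%:E - (Num.sqrt (f a ^+ 2 + n.+1%:R^-1))%:E)%E.
  have dk x : a <= x <= b -> is_derive x 1 (fun x => Num.sqrt (f x ^+ 2 + n.+1%:R^-1)) (k n x).
    by move=> xab; apply: sqrtr_sqrD_derive => //; exact: df.
  apply: (@continuous_FTC2 _ (k n) (fun x => Num.sqrt (f x ^+ 2 + n.+1%:R^-1))) => //.
  - split.
    + by move=> x; rewrite in_itv/= => /andP[ax xb]; case: (dk x); rewrite ?ltW.
    + apply: cvg_at_right_filter; apply: is_derive1_continuous (dk a _).
      by rewrite lexx ltW.
    + apply: cvg_at_left_filter; apply: is_derive1_continuous (dk b _).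
      by rewrite lexx ltW.
  - move=> x; rewrite in_itv/= => /andP[ax xb]; rewrite derive1E.
    by case: (dk x); rewrite ?ltW.
have [||||||_ _] := @dominated_convergence _ _ _ mu `[a, b] _ (fun n => EFin \o k n)
  (EFin \o (fun s => Num.sg (f s) * f1 s)) (EFin \o (fun s => `|f1 s|)).
- exact: measurable_itv.
- by move=> n; apply/measurable_EFinP; apply: mcont; exact: ck.
- apply/measurable_EFinP; apply: measurable_funM; last exact: mcont.
  apply: measurableT_comp; [exact: measurable_sgr|exact: mcont].
- apply: aeW => x _; apply: cvg_EFin; first exact: nearW.
  (* At a zero of [f] all approximating derivatives are 0, in agreement with the convention
     [sg 0 = 0]. *)
  rewrite /comp/=; have [fx|fx0] := eqVneq (f x) 0.
    rewrite fx sgr0 mul0r (_ : (fun n => _) = cst 0); first exact: cvg_cst.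
    by apply/funext => n; rewrite /k fx !mul0r.
  rewrite (_ : Num.sg (f x) * f1 x = f x * f1 x / `|f x|); last first.
    by rewrite {2}[f x]numEsg; field; rewrite normr_eq0.
  apply: cvgM; first exact: cvg_cst.
  by apply: cvgV; [rewrite normr_eq0|exact: sqrtr_sqrD_cvg].
- apply: continuous_compact_integrable; first exact: segment_compact.
  by move=> x; apply: cvg_norm; exact: cf1.
- apply: aeW => x n _ /=; rewrite lee_fin /k normrM normrM normfV.
  rewrite [in X in X^-1]ger0_norm ?sqrtr_ge0//.
  rewrite ler_pdivrMr// mulrC ler_wpM2l//.
  by rewrite -sqrtr_sqr ler_wsqrtr// lerDl ltW.
rewrite /comp/= => H.
apply: (cvg_unique _ H) => //.
rewrite (_ : (fun n => _) = fun n : nat => (Num.sqrt (f b ^+ 2 + n.+1%:R^-1) -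
   Num.sqrt (f a ^+ 2 + n.+1%:R^-1))%:E); last first.
  by apply/funext => n /=; rewrite FTC.
apply: cvg_EFin; first exact: nearW.
by apply: cvgB; exact: sqrtr_sqrD_cvg.
Qed.

(** On compact subintervals of (0,1) the chain rule for [|f|] is [norm_FTC]. Hence [|f|] minus the
    primitive of [sg f * g] is constant inside and, being continuous, on all of [0,1]. This copes
    with a [derive1 f] that may be unbounded near the collision time 0. *)
Lemma is_H1_abs f g : is_H1 f g ->
  (forall t, 0 < t < 1 -> is_derive t 1 f (derive1 f t)) ->
  (forall t, 0 < t < 1 -> {for t, continuous (derive1 f)}) ->
  is_H1 (fun t => `|f t|) (fun t => Num.sg (f t) * g t).
Proof.
move=> fg df cf1; have [mg ig2 fE] := fg; have ig := is_H1_integrable fg.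
have msg : measurable_fun I01 (fun t => Num.sg (f t) * g t).
  apply: measurable_funM => //; apply: measurableT_comp.
    exact: measurable_sgr.
  exact: is_H1_measurable fg.
have sg1 y : `|Num.sg y| <= 1 :> R by rewrite normr_sg; case: (y != 0).
have isg : mu.-integrable I01 (EFin \o (fun t => Num.sg (f t) * g t)).
  apply: integrable_dominated ig => // s _.
  by rewrite normrM ler_piMl.
split => //.
  apply: le_lt_trans ig2; apply: ge0_le_integral => //.
  - by move=> s _; rewrite lee_fin sqr_ge0.
  - by apply/measurable_EFinP; exact: measurable_funX.
  - by apply/measurable_EFinP; exact: measurable_funX.
  - move=> s _; rewrite lee_fin exprMn ler_piMl ?sqr_ge0//.
    by rewrite -real_normK ?num_real// expr_le1.
pose H t := `|f t| - \int[mu]_(s in `[0, t]) (Num.sg (f s) * g s).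
have cH : {within I01, continuous H}.
  move=> t; apply: cvgB.
    by apply: cvg_norm; exact: is_H1_within_continuous fg t.
  exact: (parameterized_integral_continuous ler01 isg).
have Hab a b : 0 < a -> a < b -> b < 1 -> H b = H a.
  move=> a0 ab b1.
  have sab : `[a, b] `<=` I01 by apply: subset_I01; exact: ltW.
  have E : \int[mu]_(s in `[a, b]) (Num.sg (f s) * g s) = `|f b| - `|f a|.
    have Hs x : a <= x <= b -> 0 < x < 1.
      by move=> /andP[ax xb]; rewrite (lt_le_trans a0)//= (le_lt_trans xb).
    have cab : {within `[a, b], continuous (derive1 f)}.
      apply: continuous_in_subspaceT => x; rewrite inE/= in_itv/= => xab.
      exact/cf1/Hs.
    have := norm_FTC ab (fun x xab => df x (Hs x xab)) cab.
    rewrite /Rintegral => N.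
    transitivity (fine (\int[mu]_(s in `[a, b]) (Num.sg (f s) * derive1 f s)%:E)%E).
      congr fine; apply: ae_eq_integral => //.
      - by apply/measurable_EFinP; exact: measurable_funS msg.
      - apply/measurable_EFinP; apply: measurable_funM.
          apply: measurableT_comp; first exact: measurable_sgr.
          by apply: measurable_funS (is_H1_measurable fg).
        exact: subspace_continuous_measurable_fun.
      - have := is_H1_derive_ae fg.
        apply: filterS; first exact: (ae_filter_ringOfSetsType mu).
        by move=> x /= xE; rewrite in_itv/= => /Hs /xE ->.
    by rewrite N.
  rewrite /H; apply/eqP; rewrite subr_eq -addrA [X in _ + X]addrC.
  rewrite Rintegral_itvB ?bnd_simp ?(ltW a0) ?(ltW ab)//; last first.
    by apply: integrableS isg => //; apply: subset_I01 => //; exact: ltW.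
  rewrite Rintegral_itv_obnd_cbnd ?E ?subrKC//.
  by apply: integrableS isg => //; apply: subset_trans sab; exact: subset_itv_oc_cc.
have H12 x : 0 < x < 1 -> H x = H 2^-1.
  move=> /andP[x0 x1]; have h0 : 0 < 2^-1 :> R by rewrite invr_gt0.
  have h1 : 2^-1 < 1 :> R by rewrite invf_lt1// ltr1n.
  by have [l|l|->//] := ltgtP x 2^-1; [rewrite (Hab x 2^-1)|rewrite (Hab 2^-1 x)].
have HE := cvg_within01_eq cH H12.
move=> t t01; have Ht := HE t t01.
have H0 : H 0 = H 2^-1 by apply: HE; rewrite lexx ler01.
have H00 : H 0 = `|f 0| by rewrite /H set_itv1 Rintegral_set1 subr0.
by rewrite -H00 H0 -Ht /H subrK.
Qed.

(** For [al < 1] the integrand is unbounded at 0, so the fundamental theorem is applied on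
    [[t / (i + 1), t]] and the integrals increase to the one over []0, t]]. *)
Lemma integral_powR (al t : R) : 0 < al -> 0 < t ->
  (\int[mu]_(s in `[0%R, t]) ((al * s `^ (al - 1))%R)%:E)%E = (t `^ al)%:E.
Proof.
move=> al0 t0.
pose F (i : nat) : set (measurableTypeR R) := `[t / i.+1%:R, t]%classic.
have mp : measurable_fun setT (fun s : R => al * s `^ (al - 1)).
  by apply: measurable_funM => //; exact: measurable_powR.
have UF : \bigcup_i F i = `]0, t]%classic.
  apply/seteqP; split => s /=.
    move=> [i _]; rewrite /F/= !in_itv/= => /andP[s1 ->]; rewrite andbT.
    by rewrite (lt_le_trans _ s1)// divr_gt0.
  rewrite in_itv/= => /andP[s0 st].
  have [n /ltW tn] : exists n : nat, t / s < n.+1%:R.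
    exists (Num.bound (t / s)); apply: lt_trans (archi_boundP _) _.
      by rewrite divr_ge0// ltW.
    by rewrite ltr_nat.
  exists n => //; rewrite /F/= in_itv/= st andbT ler_pdivrMr// mulrC.
  by move: tn; rewrite ler_pdivrMr.
rewrite -integral_itv_obnd_cbnd; last first.
  by apply/measurable_EFinP; exact: measurable_funTS.
rewrite -UF.
have ndF : {homo F : n m / (n <= m)%N >-> (n <= m)%O}.
  move=> n m nm; rewrite subsetEset /F => s /=; rewrite !in_itv/= => /andP[s1 ->].
  rewrite andbT (le_trans _ s1)// ler_pM2l// lef_pV2 ?posrE ?ltr0n// ler_nat.
  by rewrite ltnS.
have := @ge0_nondecreasing_set_cvg_integral _ (measurableTypeR R) R F
  (fun s => ((al * s `^ (al - 1))%R)%:E) mu ndF.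
move=> /(_ _ _ _)/wrap[].
- by move=> i; exact: measurable_itv.
- by move=> i; apply/measurable_EFinP; exact: measurable_funTS.
- by move=> i x _; rewrite lee_fin mulr_ge0 ?powR_ge0// ltW.
move=> H; apply: (cvg_unique _ H) => //.
rewrite (_ : (fun i => _) = fun i : nat => (t `^ al - (t / i.+1%:R) `^ al)%:E); last first.
  apply/funext => i; rewrite /F.
  have ti0 : 0 < t / i.+1%:R by rewrite divr_gt0.
  case: i ti0 => [|i] ti0.
    by rewrite divr1 set_itv1 integral_set1 subrr.
  have tit : t / i.+2%:R < t by rewrite ltr_pdivrMr// ltr_pMr// ltr1n.
  have dp x : t / i.+2%:R <= x -> is_derive x 1 (fun s => s `^ al) (al * x `^ (al - 1)).
    by move=> tx; apply: is_derive1_powR; exact: lt_le_trans tx.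
  rewrite (@continuous_FTC2 _ (fun s => al * s `^ (al - 1)) (fun s => s `^ al))//.
  - apply: continuous_in_subspaceT => x; rewrite inE/= in_itv/= => /andP[tx _].
    apply: cvgM; first exact: cvg_cst.
    apply: (@is_derive1_continuous _ (fun s => s `^ (al - 1))).
    by apply: is_derive1_powR; exact: lt_le_trans tx.
  - split.
    + by move=> x; rewrite in_itv/= => /andP[tx _]; case: (dp x (ltW tx)).
    + by apply: cvg_at_right_filter; apply: is_derive1_continuous (dp _ _).
    + by apply: cvg_at_left_filter; apply: is_derive1_continuous (dp _ (ltW _)).
  - move=> x; rewrite in_itv/= => /andP[tx _]; rewrite derive1E.
    by case: (dp x (ltW tx)).
apply: cvg_EFin; first exact: nearW.
rewrite -[X in _ --> X]subr0; apply: cvgB; first exact: cvg_cst.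
have /cvg_at_rightP/(_ (fun i : nat => t / i.+1%:R)) := powR_cvg0 al0.
apply; split; first by move=> n; rewrite divr_gt0.
rewrite -(mulr0 t); apply: cvgM; first exact: cvg_cst.
exact: cvg_harmonic.
Qed.

Lemma is_H1_powR (al : R) : 2^-1 < al ->
  is_H1 (fun s => s `^ al) (fun s => al * s `^ (al - 1)).
Proof.
move=> al2; have al0 : 0 < al by apply: lt_trans al2; rewrite invr_gt0.
have mp (k e : R) : measurable_fun setT (fun s : R => k * s `^ e).
  by apply: measurable_funM => //; exact: measurable_powR.
split.
- exact: measurable_funTS.
(* This is where [al > 1/2] enters: the squared derivative is a multiple of the derivative of
   [s^(2 al - 1)], which is integrable at 0 for a positive exponent. *)
- have b0 : 0 < al * 2 - 1 by lra.
  have := integral_powR b0 ltr01; rewrite powR1.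
  have -> : (\int[mu]_(s in I01) (((al * s `^ (al - 1)) ^+ 2)%R)%:E =
    \int[mu]_(s in I01) ((al ^+ 2 / (al * 2 - 1))%R%:E * ((al * 2 - 1) * s `^ (al * 2 - 1 - 1))%R%:E))%E.
    apply: eq_integral => s; rewrite inE/= in_itv/= => /andP[s0 _].
    rewrite -EFinM; congr EFin.
    rewrite exprMn -[(s `^ _) ^+ 2]powR_mulrn ?powR_ge0// -powRrM.
    rewrite (_ : (al - 1) * 2%:R = al * 2 - 1 - 1); last by ring.
    by field; rewrite gt_eqF.
  rewrite ge0_integralZl_EFin//.
  + by move=> ->; rewrite mule1 ltry.
  + by move=> s _; rewrite lee_fin mulr_ge0 ?powR_ge0// ltW.
  + by apply/measurable_EFinP; apply: measurable_funTS; exact: mp.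
  + by rewrite divr_ge0 ?sqr_ge0// ltW.
- move=> t /andP[]; rewrite le_eqVlt => /predU1P[<- _|t0 _].
    by rewrite set_itv1 Rintegral_set1 addr0.
  by rewrite powR0 ?gt_eqF// add0r /Rintegral integral_powR.
Qed.

End AbsoluteValueAndPowers.

(** * The variational problem in Jacobi coordinates *)

Section JacobiProblem.
Variable R : realType.
Implicit Types (f g : R -> R) (c h t x : R).
Local Notation mu := (@lebesgue_measure R).
Local Notation I01 := `[(0:R), (1:R)]%classic.

(* A configuration [C j d] holds coordinate [d] ([false] for x, [true] for y)
   of the Jacobi vector [Z1] ([j = false]) or [Z2] ([j = true]). *)
Definition jconf := bool -> bool -> R.
Definition jpath := bool -> bool -> R -> R.
Implicit Types (C W : jconf) (Z V : jpath).

Definition conf_at Z t : jconf := fun j d => Z j d t.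

(** The reduced masses of the pair of bodies 1 and 2, and of body 3 relative to that pair. *)
Definition mass (j : bool) : R := if j then 2 / 3 else 2^-1.

Definition jkin W : R :=
  2^-1 * (mass false * (W false false ^+ 2 + W false true ^+ 2) +
          mass true * (W true false ^+ 2 + W true true ^+ 2)).

(** The coefficients (1, 0), (-1/2, 1) and (1/2, 1) give [q1 - q2], [q3 - q1] and [q3 - q2]. *)
Definition pairv (la ka : R) C : pt R :=
  (la * C false false + ka * C true false, la * C false true + ka * C true true).

Definition inv_norm (z : pt R) : \bar R :=
  if z == (0, 0) then +oo%E else ((pnorm z)^-1)%:E.

Definition jpot C : \bar R :=
  (inv_norm (pairv 1 0 C) + inv_norm (pairv (- 2^-1) 1 C) +
   inv_norm (pairv 2^-1 1 C))%E.

Definition jlag Z V t : \bar R :=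
  ((jkin (conf_at V t))%:E + jpot (conf_at Z t))%E.

Definition jact Z V : \bar R := (\int[mu]_(t in I01) jlag Z V t)%E.

(** The boundary sets translated: [Q_S4] becomes [Z1 = 0], [Z2 = (3 a2, 0)], and [Q_E1] becomes
    [Z1 = (b2, - 3 b1)], [Z2 = (3/2 b2, 3/2 b1)]. Eliminating [b1] and [b2] leaves the two relations
    at time 1. *)
Definition jadm Z V : Prop :=
  (forall j d, is_H1 (Z j d) (V j d)) /\
  [/\ Z false false 0 = 0, Z false true 0 = 0, Z true true 0 = 0,
      0 <= Z true false 0 &
      Z true false 1 = 3 / 2 * Z false false 1 /\
      Z false true 1 = - 2 * Z true true 1].

Definition jmin Z V : Prop :=
  jadm Z V /\ forall Z' V', jadm Z' V' -> (jact Z V <= jact Z' V')%E.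

Lemma pnorm2_ge0 (z : pt R) : 0 <= pnorm2 z.
Proof. by rewrite addr_ge0// sqr_ge0. Qed.

Lemma pnorm2_eq0 (z : pt R) : (pnorm2 z == 0) = (z == (0, 0)).
Proof.
by case: z => a b; rewrite /pnorm2 paddr_eq0 ?sqr_ge0//= !sqrf_eq0 xpair_eqE.
Qed.

Lemma pnorm_gt0 (z : pt R) : z != (0, 0) -> 0 < pnorm z.
Proof.
by move=> z0; rewrite sqrtr_gt0 lt_neqAle pnorm2_ge0 andbT eq_sym pnorm2_eq0.
Qed.

Lemma inv_norm_ge0 (z : pt R) : (0 <= inv_norm z)%E.
Proof. by rewrite /inv_norm; case: ifP => // _; rewrite lee_fin invr_ge0 sqrtr_ge0. Qed.

Lemma jkin_ge0 W : 0 <= jkin W.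
Proof.
rewrite /jkin /mass; have := sqr_ge0 (W false false); have := sqr_ge0 (W false true).
have := sqr_ge0 (W true false); have := sqr_ge0 (W true true); lra.
Qed.

Lemma jpot_ge0 C : (0 <= jpot C)%E.
Proof. by rewrite !adde_ge0// inv_norm_ge0. Qed.

Lemma jlag_ge0 Z V t : (0 <= jlag Z V t)%E.
Proof. by rewrite adde_ge0 ?jpot_ge0// lee_fin jkin_ge0. Qed.

Lemma measurable_inv_norm (f g : R -> R) :
  measurable_fun I01 f -> measurable_fun I01 g ->
  measurable_fun I01 (fun t => inv_norm (f t, g t)).
Proof.
move=> mf mg; pose n2 t := f t ^+ 2 + g t ^+ 2.
have mn : measurable_fun I01 n2 by apply: measurable_funD; exact: measurable_funX.
rewrite (_ : (fun t => _) =
  fun t => if n2 t == 0 then +oo%E else (n2 t `^ (- 2^-1))%:E); last first.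
  apply/funext => t; rewrite /inv_norm -pnorm2_eq0 /pnorm2/= -/(n2 t).
  case: ifP => // _; congr EFin.
  by rewrite powRN powR12_sqrt// /n2 addr_ge0// sqr_ge0.
apply: measurable_fun_if => //.
- exact: measurable_fun_eqr.
- apply/measurable_EFinP; apply: (measurableT_comp (measurable_powR _)).
  by apply: measurable_funS mn => //; exact: subIsetl.
Qed.

Lemma measurable_pairv la ka Z V : (forall j d, is_H1 (Z j d) (V j d)) ->
  measurable_fun I01 (fun t => inv_norm (pairv la ka (conf_at Z t))).
Proof.
move=> hZ; apply: measurable_inv_norm.
- by apply: measurable_funD; apply: measurable_funM => //; exact: is_H1_measurable (hZ _ _).
- by apply: measurable_funD; apply: measurable_funM => //; exact: is_H1_measurable (hZ _ _).
Qed.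

Lemma measurable_jlag Z V : (forall j d, is_H1 (Z j d) (V j d)) ->
  measurable_fun I01 (jlag Z V).
Proof.
move=> hZ; apply: emeasurable_funD.
  have mV j d : measurable_fun I01 (fun t => V j d t ^+ 2).
    by apply: measurable_funX; case: (hZ j d).
  apply/measurable_EFinP; rewrite /jkin.
  apply: measurable_funM => //; apply: measurable_funD.
    by apply: measurable_funM => //; apply: measurable_funD; exact: mV.
  by apply: measurable_funM => //; apply: measurable_funD; exact: mV.
by apply: emeasurable_funD; [apply: emeasurable_funD|]; exact: measurable_pairv.
Qed.

Lemma inv_normN (a b : R) : inv_norm (- a, - b) = inv_norm (a, b).
Proof. by rewrite /inv_norm !xpair_eqE !oppr_eq0 /pnorm /pnorm2/= !sqrrN. Qed.

Lemma inv_distE (a b : pt R) : inv_dist a b = inv_norm (psub a b).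
Proof.
by case: a b => [a1 a2] [b1 b2]; rewrite /inv_dist /inv_norm /psub/= !xpair_eqE !subr_eq0.
Qed.

Definition jacobi (q : path3 R) : jpath := fun j d t =>
  let z := if j then Z2 q t else Z1 q t in if d then z.2 else z.1.

(** Coefficients of the inverse change of coordinates with centre of mass at the origin:
    [q1 = Z1/2 - Z2/3], [q2 = - Z1/2 - Z2/3], [q3 = 2/3 Z2]. *)
Definition jcoef1 (i : 'I_3) : R :=
  if i == b1 then 2^-1 else if i == b2 then - 2^-1 else 0.
Definition jcoef2 (i : 'I_3) : R := if i == b3 then 2 / 3 else - (3^-1).

Definition of_jacobi Z : path3 R := fun i t =>
  (jcoef1 i * Z false false t + jcoef2 i * Z true false t,
   jcoef1 i * Z false true t + jcoef2 i * Z true true t).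

Lemma is_H1_lin f g f' g' (k k' : R) : is_H1 f g -> is_H1 f' g' ->
  is_H1 (fun t => k * f t + k' * f' t) (fun t => k * g t + k' * g' t).
Proof. by move=> fg fg'; apply: is_H1D; exact: is_H1Z. Qed.

Lemma jpot_jacobi (q : path3 R) t :
  (inv_dist (q b1 t) (q b2 t) + inv_dist (q b1 t) (q b3 t) +
   inv_dist (q b2 t) (q b3 t))%E = jpot (conf_at (jacobi q) t).
Proof.
rewrite !inv_distE /jpot /pairv /conf_at /jacobi /Z1 /Z2 /psub /pscale /padd/=.
congr (_ + _ + _)%E.
- by congr inv_norm; congr pair; ring.
- by rewrite -inv_normN; congr inv_norm; congr pair; field.
- by rewrite -inv_normN; congr inv_norm; congr pair; field.
Qed.

(* The kinetic energies differ by a sixth of the squared total momentum. *)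
Lemma jlag_le_lagrangian (q v : path3 R) t :
  (jlag (jacobi q) (jacobi v) t <= lagrangian q v t)%E.
Proof.
rewrite /lagrangian -!addeA [X in (_ <= _ + X)%E]addeA jpot_jacobi leeD2r// lee_fin.
rewrite /jkin /conf_at /jacobi /Z1 /Z2 /psub /pscale /padd /pnorm2 /mass/=.
move: (v b1 t) (v b2 t) (v b3 t) => [x1 y1] [x2 y2] [x3 y3] /=.
have := sqr_ge0 (x1 + x2 + x3); have := sqr_ge0 (y1 + y2 + y3); nra.
Qed.

Lemma jlag_of_jacobi Z V t : lagrangian (of_jacobi Z) (of_jacobi V) t = jlag Z V t.
Proof.
rewrite /lagrangian -!addeA [X in (_ + X)%E]addeA jpot_jacobi /jlag; congr (_%:E + _)%E.
  by rewrite /pnorm2 /of_jacobi /jkin /conf_at /jcoef1 /jcoef2 /mass/=; field.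
congr jpot; apply/funext => j; apply/funext => d.
rewrite /conf_at /jacobi /Z1 /Z2 /psub /pscale /padd /of_jacobi /jcoef1 /jcoef2/=.
by case: j; case: d => /=; field.
Qed.

Lemma jadm_jacobi (q v : path3 R) : admissible q v -> jadm (jacobi q) (jacobi v).
Proof.
move=> [hq [_ [[a2 [a20 [q1 [q2 q3]]]] [b1' [b2' [e1 [e2 e3]]]]]]].
have hx i : is_H1 (fun t => (q i t).1) (fun t => (v i t).1).
  by have [? [_ [? [_ E]]]] := hq i; split => // t /E[].
have hy i : is_H1 (fun t => (q i t).2) (fun t => (v i t).2).
  by have [_ [? [_ [? E]]]] := hq i; split => // t /E[].
split.
  move=> j d.
  have eqH1 f g f' g' : is_H1 f g -> f = f' -> g = g' -> is_H1 f' g'.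
    by move=> H <- <-.
  case: j; case: d; rewrite /jacobi/= /Z1 /Z2 /psub /pscale /padd/=.
  - apply: (eqH1 _ _ _ _ (is_H1_lin 1 (- 2^-1) (hy b3)
      (is_H1_lin 1 1 (hy b1) (hy b2)))); apply/funext => t; ring.
  - apply: (eqH1 _ _ _ _ (is_H1_lin 1 (- 2^-1) (hx b3)
      (is_H1_lin 1 1 (hx b1) (hx b2)))); apply/funext => t; ring.
  - apply: (eqH1 _ _ _ _ (is_H1_lin 1 (- 1) (hy b1) (hy b2))); apply/funext => t; ring.
  - apply: (eqH1 _ _ _ _ (is_H1_lin 1 (- 1) (hx b1) (hx b2))); apply/funext => t; ring.
rewrite /jacobi /Z1 /Z2 /psub /pscale /padd/= q1 q2 q3 e1 e2 e3 /=; split; [ring|ring|ring|lra|].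
by split; field.
Qed.

Lemma admissible_of_jacobi Z V : jadm Z V -> admissible (of_jacobi Z) (of_jacobi V).
Proof.
move=> [hZ [x10 y10 y20 x20 [x1 y1]]]; split; last split; last split.
- move=> i.
  have [m1 i1 E1] := is_H1_lin (jcoef1 i) (jcoef2 i) (hZ false false) (hZ true false).
  have [m2 i2 E2] := is_H1_lin (jcoef1 i) (jcoef2 i) (hZ false true) (hZ true true).
  by split => //; split => //; split => //; split => // t t01; split; [exact: E1|exact: E2].
- move=> t _; rewrite /in_chi /padd /of_jacobi /jcoef1 /jcoef2/=.
  by congr pair; field.
- exists (Z true false 0 / 3); rewrite /of_jacobi /jcoef1 /jcoef2/= x10 y10 y20.
  split; first by rewrite divr_ge0.
  by split; [|split]; congr pair; field.
- exists (2 / 3 * Z true true 1), (Z false false 1).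
  rewrite /of_jacobi /jcoef1 /jcoef2/= x1 y1.
  by split; [|split]; congr pair; field.
Qed.

(** For the minimizer itself an inequality between the two Lagrangians is enough, while competitors
    built by [of_jacobi] give equality. This avoids proving that the velocities [v] sum to zero
    almost everywhere. *)
Lemma jmin_jacobi (q v : path3 R) : is_minimizer q v -> jmin (jacobi q) (jacobi v).
Proof.
move=> [aq mq]; split; first exact: jadm_jacobi.
move=> Z V aZ; apply: (@le_trans _ _ (action q v)).
  have [hq _] := jadm_jacobi aq.
  apply: ge0_le_integral => //.
  - by move=> t _; exact: jlag_ge0.
  - exact: measurable_jlag.
  - rewrite /lagrangian; apply: emeasurable_funD; last first.
      have := measurable_pairv 2^-1 1 hq; apply: eq_measurable_fun => t _.
      rewrite inv_distE -inv_normN /pairv /conf_at /jacobi /Z1 /Z2 /psub /pscale /padd/=.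
      by congr inv_norm; congr pair; field.
    apply: emeasurable_funD; last first.
      have := measurable_pairv (- 2^-1) 1 hq; apply: eq_measurable_fun => t _.
      rewrite inv_distE -inv_normN /pairv /conf_at /jacobi /Z1 /Z2 /psub /pscale /padd/=.
      by congr inv_norm; congr pair; field.
    apply: emeasurable_funD; last first.
      have := measurable_pairv 1 0 hq; apply: eq_measurable_fun => t _.
      rewrite inv_distE /pairv /conf_at /jacobi /Z1 /Z2 /psub /pscale /padd/=.
      by congr inv_norm; congr pair; ring.
    have [H _] := aq.
    have mv i : measurable_fun I01 (fun t => pnorm2 (v i t)).
      by have [? [? _]] := H i; apply: measurable_funD; exact: measurable_funX.
    apply/measurable_EFinP; apply: measurable_funM => //.
    by apply: measurable_funD; [apply: measurable_funD|]; exact: mv.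
  - by move=> t _; exact: jlag_le_lagrangian.
apply: le_trans (mq _ _ (admissible_of_jacobi aZ)) _.
rewrite /action /jact le_eqVlt; apply/orP; left; apply/eqP.
by apply: eq_integral => t _; exact: jlag_of_jacobi.
Qed.

(** The competitor moves on the x-axis with [Z1x = t^(2/3)] and [Z2x = 3/2], which meets the
    relation [Z2x = 3/2 Z1x] at time 1. Both [|Z1'|^2] and [1/|Z1|] are then multiples of
    [t^(-2/3)], which is integrable. *)
Lemma jmin_finite Z V : jmin Z V -> (jact Z V < +oo)%E.
Proof.
move=> [_ mZ].
pose Z' : jpath := fun j d => if d then fun=> 0 else if j then fun=> 3 / 2
  else fun t => t `^ (2 / 3).
pose V' : jpath := fun j d => if d then fun=> 0 else if j then fun=> 0
  else fun t => 2 / 3 * t `^ (2 / 3 - 1).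
have pw : is_H1 (fun t : R => t `^ (2 / 3)) (fun t => 2 / 3 * t `^ (2 / 3 - 1)).
  by apply: is_H1_powR; lra.
have aZ' : jadm Z' V'.
  split; first by case; case; rewrite /Z' /V'//; exact: is_H1_cst.
  rewrite /Z'/= powR0 ?powR1; last by rewrite gt_eqF// divr_gt0.
  by split => //; split; [rewrite mulr1|rewrite mulr0].
apply: le_lt_trans (mZ _ _ aZ') _.
(* The exponent is [-2/3], written as for the derivative of [t^(1/3)]. The kinetic energy
   contributes [1/9] and the pair of bodies 1 and 2 contributes 1, within the 3; the summand 2
   covers the other two pairs, whose distances are at least 1. *)
pose k : R -> \bar R := fun t => ((9%:R^-1 + 3) * t `^ (3^-1 - 1) + 2)%:E.
have mk : measurable_fun I01 k.
  apply/measurable_EFinP; apply: measurable_funD => //; apply: measurable_funM => //.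
  by apply: measurable_funTS; exact: measurable_powR.
have h3 : 0 < 3^-1 :> R by rewrite invr_gt0.
have kE : (\int[mu]_(t in I01) k t =
    \int[mu]_(t in I01) ((3 * (9%:R^-1 + 3))%:E * (3^-1 * t `^ (3^-1 - 1))%R%:E + 2%:E))%E.
  apply: eq_integral => t _; rewrite /k -EFinM -EFinD; congr EFin.
  by field.
have kfin : (\int[mu]_(t in I01) k t < +oo)%E.
  have mp : measurable_fun I01 (fun t => (3^-1 * t `^ (3^-1 - 1))%R%:E).
    apply/measurable_EFinP; apply: measurable_funM => //.
    by apply: measurable_funTS; exact: measurable_powR.
  have p0 t : (0 <= (3^-1 * t `^ (3^-1 - 1))%R%:E)%E.
    by rewrite lee_fin mulr_ge0 ?powR_ge0// ltW.
  rewrite kE ge0_integralD//.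
  - rewrite ge0_integralZl_EFin//.
    rewrite (integral_powR h3 ltr01) integral_cst// powR1 mule1.
    rewrite lte_add_pinfty ?ltry//.
    by rewrite lte_mul_pinfty//; exact: measure_I01.
  - by move=> t _; rewrite mule_ge0// lee_fin mulr_ge0.
  - exact: measurable_funeM.
apply: le_lt_trans kfin.
(* Time 0 is removed: there the Lagrangian of the competitor is infinite while [k] is finite. *)
rewrite /jact -integral_itv_obnd_cbnd; last first.
  apply: measurable_funS (measurable_jlag (proj1 aZ')) => //.
  exact: subset_itv_oc_cc.
rewrite -[leRHS]integral_itv_obnd_cbnd; last first.
  by apply: measurable_funS mk => //; exact: subset_itv_oc_cc.
apply: ge0_le_integral => //.
- by move=> t _; exact: jlag_ge0.
- apply: measurable_funS (measurable_jlag (proj1 aZ')) => //.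
  exact: subset_itv_oc_cc.
- by apply: measurable_funS mk => //; exact: subset_itv_oc_cc.
move=> t /=; rewrite in_itv/= => /andP[t0 t1].
rewrite /jlag /jkin /jpot /conf_at /pairv /Z' /V'/= !mulr0 !mul1r !mul0r !addr0 expr0n/= !addr0.
set r := t `^ (2 / 3).
have r0 : 0 < r by exact: powR_gt0.
have r1 : r <= 1.
  have e1 : 1 `^ (2 / 3) = 1 :> R by rewrite powR1.
  by rewrite -[leRHS]e1 /r ge0_ler_powR ?nnegrE ?(ltW t0)// divr_ge0.
have invE (a b : R) : 0 < a -> inv_norm (a, 0) = (a^-1)%:E.
  move=> a0; rewrite /inv_norm xpair_eqE gt_eqF//= /pnorm /pnorm2/= expr0n addr0.
  by rewrite sqrtr_sqr gtr0_norm.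
rewrite !invE//; [|by rewrite ltr_wpDl ?divr_gt0// mulr_ge0// ltW|lra].
rewrite -!EFinD lee_fin.
have -> : (2 / 3 * t `^ (2 / 3 - 1)) ^+ 2 = 4 / 9 * t `^ (3^-1 - 1).
  rewrite exprMn -[(t `^ _) ^+ 2]powR_mulrn ?powR_ge0// -powRrM.
  by congr (_ * _ `^ _); field.
have rV : r^-1 = t `^ (3^-1 - 1).
  by rewrite /r -powRN; congr (_ `^ _); field.
rewrite -rV.
have i0 : 0 < r^-1 by rewrite invr_gt0.
have h1 : (- 2^-1 * r + 3 / 2)^-1 <= 1 by rewrite invf_le1; lra.
have h2 : (2^-1 * r + 3 / 2)^-1 <= 1 by rewrite invf_le1; lra.
by rewrite /mass; lra.
Qed.

End JacobiProblem.

(** * First variation of the action along tents *)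

Section EulerLagrange.
Variable R : realType.
Implicit Types (f g : R -> R) (c h t x : R) (C W : jconf R) (Z V : jpath R).
Local Notation mu := (@lebesgue_measure R).
Local Notation I01 := `[(0:R), (1:R)]%classic.

Definition pdot (z w : pt R) : R := z.1 * w.1 + z.2 * w.2.

(* For [A = |z|] and [B = |z + tau w|],
   [1/B - 1/A = - tau (2 z.w + tau |w|^2) / (A B (A + B))]. *)
Lemma inv_norm_increment (z0 w : pt R) (eta : R) : z0 != (0, 0) -> 0 < eta ->
  exists2 rho : R, 0 < rho & forall (z : pt R) (tau : R),
    `|z.1 - z0.1| < rho -> `|z.2 - z0.2| < rho -> `|tau| < rho ->
    (inv_norm (z.1 + tau * w.1, z.2 + tau * w.2)%R <=
     inv_norm z + (tau * (- pdot z0 w / pnorm z0 ^+ 3) + eta * `|tau|)%:E)%E.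
Proof.
case: z0 w => [z1 z2] [w1 w2] z0 eta0; rewrite /pdot/=.
pose p0 : R * R * R := ((z1, z2), 0).
pose A (x : R * R * R) : R := Num.sqrt (x.1.1 * x.1.1 + x.1.2 * x.1.2).
pose B (x : R * R * R) : R := Num.sqrt ((x.1.1 + x.2 * w1) * (x.1.1 + x.2 * w1) +
  (x.1.2 + x.2 * w2) * (x.1.2 + x.2 * w2)).
pose Q (x : R * R * R) : R := - (2 * (x.1.1 * w1 + x.1.2 * w2) + x.2 * (w1 * w1 + w2 * w2)) /
  (A x * B x * (A x + B x)).
have A0 : 0 < A p0 by have := pnorm_gt0 z0; rewrite /pnorm /pnorm2 !expr2.
have AE : A p0 = pnorm (z1, z2) by rewrite /A /pnorm /pnorm2 !expr2.
have BE : B p0 = A p0 by rewrite /B /A/= !mul0r !addr0.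
have c11 : x.1.1 @[x --> p0] --> p0.1.1.
  exact: (cvg_comp _ _ cvg_fst cvg_fst).
have c12 : x.1.2 @[x --> p0] --> p0.1.2.
  exact: (cvg_comp _ _ cvg_fst cvg_snd).
have c2 : x.2 @[x --> p0] --> p0.2 by exact: cvg_snd.
have cA : A x @[x --> p0] --> A p0.
  rewrite /A; apply: continuous_cvg; first exact: sqrt_continuous.
  by apply: cvgD; apply: cvgM.
have cB : B x @[x --> p0] --> B p0.
  rewrite /B; apply: continuous_cvg; first exact: sqrt_continuous.
  by apply: cvgD; apply: cvgM; apply: cvgD => //; apply: cvgM => //; exact: cvg_cst.
have cQ : Q x @[x --> p0] --> Q p0.
  apply: cvgM.
    apply: cvgN; apply: cvgD.
      apply: cvgM; first exact: cvg_cst.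
      by apply: cvgD; apply: cvgM => //; exact: cvg_cst.
    by apply: cvgM => //; exact: cvg_cst.
  apply: cvgV.
    by rewrite BE !mulf_neq0// ?gt_eqF// addr_gt0.
  by apply: cvgM; [apply: cvgM|apply: cvgD].
have QE : Q p0 = - (z1 * w1 + z2 * w2) / pnorm (z1, z2) ^+ 3.
  rewrite /Q BE -AE/= mul0r addr0; field.
  by rewrite -mulr2n mulrn_eq0/= gt_eqF.
have nA : \forall x \near p0, 0 < A x by apply: cvgr_gt cA _ A0.
have nB : \forall x \near p0, 0 < B x by apply: cvgr_gt cB _ _; rewrite BE.
have nQ : \forall x \near p0, `|Q p0 - Q x| <= eta by move/cvgrPdist_le : cQ => /(_ _ eta0).
have : \forall x \near p0, [/\ 0 < A x, 0 < B x & `|Q p0 - Q x| <= eta].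
  by near=> x; split; near: x.
move=> /nbhs_ballP[rho /= rho0 H]; exists rho => // -[a b] tau /= az bz ta.
have [] := H (a, b, tau).
  split; first split => /=.
  - by rewrite /ball/= distrC.
  - by rewrite /ball/= distrC.
  - by rewrite /ball/= sub0r normrN.
set x := (a, b, tau) => Ax Bx Qx.
have iE (u v : R) : 0 < Num.sqrt (u * u + v * v) ->
    inv_norm (u, v) = ((Num.sqrt (u * u + v * v))^-1)%:E.
  move=> uv; rewrite /inv_norm ifF; first by rewrite /pnorm /pnorm2/= !expr2.
  apply/negP; rewrite xpair_eqE => /andP[/eqP u0 /eqP v0].
  by move: uv; rewrite u0 v0 !mul0r addr0 sqrtr0 ltxx.
rewrite (iE _ _ Ax) (iE _ _ Bx) -EFinD lee_fin -/(A x) -/(B x).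
have A2 : A x * A x = a * a + b * b.
  by rewrite -expr2 sqr_sqrtr// addr_ge0// -expr2 sqr_ge0.
have B2 : B x * B x = (a + tau * w1) * (a + tau * w1) + (b + tau * w2) * (b + tau * w2).
  by rewrite -expr2 sqr_sqrtr// addr_ge0// -expr2 sqr_ge0.
have E : (B x)^-1 = (A x)^-1 + tau * Q x.
  have -> : (B x)^-1 = (A x)^-1 + (A x * A x - B x * B x) / (A x * B x * (A x + B x)).
    by field; rewrite !gt_eqF// addr_gt0.
  congr (_ + _); rewrite A2 B2 /Q mulrA; congr (_ / _).
  by rewrite /=; ring.
rewrite E lerD2l -QE.
have : tau * Q x - tau * Q p0 <= eta * `|tau|.
  rewrite -mulrBr (le_trans (ler_norm _))// normrM mulrC ler_wpM2r//.
  by rewrite distrC.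
by rewrite lerBlDl.
Unshelve. all: by end_near. Qed.

Definition jnocoll C : Prop :=
  [/\ pairv 1 0 C != (0, 0), pairv (- 2^-1) 1 C != (0, 0) & pairv 2^-1 1 C != (0, 0)].

Definition junit (j d : bool) : jconf R :=
  fun j' d' => if (j' == j) && (d' == d) then 1 else 0.

Definition dinv_norm (la ka : R) (j d : bool) C : R :=
  - pdot (pairv la ka C) (pairv la ka (junit j d)) / pnorm (pairv la ka C) ^+ 3.

(** A partial derivative of the potential divided by the reduced mass, that is, the acceleration
    that Newton's equations assign to this coordinate. *)
Definition force (j d : bool) C : R :=
  (dinv_norm 1 0 j d C + dinv_norm (- 2^-1) 1 j d C + dinv_norm 2^-1 1 j d C) / mass R j.

Definition jshift C (tau : R) (j d : bool) : jconf R :=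
  fun j' d' => C j' d' + tau * junit j d j' d'.

(** An upper bound suffices, since minimality supplies the lower one and [tau] takes both signs.
    Uniformity in [C] near [C0] is essential: the path moves while the tent is nonzero. *)
Lemma jpot_increment C0 (j d : bool) (eta : R) : jnocoll C0 -> 0 < eta ->
  exists2 rho : R, 0 < rho & forall C (tau : R),
    (forall j' d', `|C j' d' - C0 j' d'| < rho) -> `|tau| < rho ->
    (jpot (jshift C tau j d) <=
     jpot C + (tau * (mass R j * force j d C0) + eta * `|tau|)%:E)%E.
Proof.
move=> [n1 n2 n3] eta0.
have e3 : 0 < eta / 3 by rewrite divr_gt0.
have [r1 r10 H1] := inv_norm_increment (pairv 1 0 (junit j d)) n1 e3.
have [r2 r20 H2] := inv_norm_increment (pairv (- 2^-1) 1 (junit j d)) n2 e3.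
have [r3 r30 H3] := inv_norm_increment (pairv 2^-1 1 (junit j d)) n3 e3.
pose r := Num.min r1 (Num.min r2 r3).
have r0 : 0 < r by rewrite !lt_min r10 r20.
have [rr1 rr2 rr3] : [/\ r <= r1, r <= r2 & r <= r3].
  by split; rewrite !ge_min lexx ?orbT.
(* Half of [r], because a component of [pairv] adds the deviations of two coordinates. *)
exists (r / 2); first by rewrite divr_gt0.
move=> C tau CC tr.
have tr' : `|tau| < r by move: tr; lra.
have pc la ka : `|la| <= 1 -> `|ka| <= 1 ->
    `|(pairv la ka C).1 - (pairv la ka C0).1| < r /\
    `|(pairv la ka C).2 - (pairv la ka C0).2| < r.
  move=> la1 ka1.
  have aux (u v : R) : `|u| < r / 2 -> `|v| < r / 2 -> `|la * u + ka * v| < r.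
    move=> ur vr; rewrite (le_lt_trans (ler_normD _ _))// !normrM.
    have : `|la| * `|u| <= `|u| by rewrite ler_piMl.
    have : `|ka| * `|v| <= `|v| by rewrite ler_piMl.
    lra.
  split; rewrite /pairv/=.
    have := aux _ _ (CC false false) (CC true false).
    by congr (`| _ | < _); ring.
  have := aux _ _ (CC false true) (CC true true).
  by congr (`| _ | < _); ring.
have sh la ka : pairv la ka (jshift C tau j d) =
    ((pairv la ka C).1 + tau * (pairv la ka (junit j d)).1,
     (pairv la ka C).2 + tau * (pairv la ka (junit j d)).2).
  by rewrite /pairv /jshift/=; congr pair; ring.
have h2 : `|2^-1| <= 1 :> R by rewrite ger0_norm// invf_le1// ler1n.
rewrite /jpot !sh.
have [||p1 p2] := pc 1 0; [by rewrite normr1|by rewrite normr0|].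
have K1 := H1 _ _ (lt_le_trans p1 rr1) (lt_le_trans p2 rr1) (lt_le_trans tr' rr1).
have [||p3 p4] := pc (- 2^-1) 1; [by rewrite normrN|by rewrite normr1|].
have K2 := H2 _ _ (lt_le_trans p3 rr2) (lt_le_trans p4 rr2) (lt_le_trans tr' rr2).
have [||p5 p6] := pc 2^-1 1; [by []|by rewrite normr1|].
have K3 := H3 _ _ (lt_le_trans p5 rr3) (lt_le_trans p6 rr3) (lt_le_trans tr' rr3).
apply: (le_trans (leeD (leeD K1 K2) K3)).
have mf : mass R j * force j d C0 = dinv_norm 1 0 j d C0 +
    dinv_norm (- 2^-1) 1 j d C0 + dinv_norm 2^-1 1 j d C0.
  rewrite /force mulrC divfK// /mass; case: (j); rewrite ?mulf_neq0// invr_eq0//.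
rewrite mf -!/(dinv_norm _ _ _ _ _).
rewrite le_eqVlt; apply/orP; left; apply/eqP.
rewrite !addeA.
rewrite [X in X = _](_ : _ = (inv_norm (pairv 1 0 C) + inv_norm (pairv (- 2^-1) 1 C) +
  inv_norm (pairv 2^-1 1 C)) +
  ((tau * dinv_norm 1 0 j d C0 + eta / 3 * `|tau|)%:E +
   (tau * dinv_norm (- 2^-1) 1 j d C0 + eta / 3 * `|tau|)%:E +
   (tau * dinv_norm 2^-1 1 j d C0 + eta / 3 * `|tau|)%:E))%E; last first.
  rewrite !addeA; congr (_ + _)%E.
  rewrite addeAC; congr (_ + _)%E.
  rewrite [RHS]addeAC; congr (_ + _)%E.
  by rewrite [LHS]addeAC.
by rewrite -!EFinD; congr (_ + _%:E)%E; field.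
Qed.

(** A triangle of height [h] over [[c - h, c + h]], with integral [h ^+ 2]. The explicit factors 1
    match the shape of [is_H1_lin] and [Rintegral_lin]. *)
Definition tent c h t : R := 1 * (1 * ramp (c - h) t + - 2 * ramp c t) + 1 * ramp (c + h) t.
Definition tentd c h t : R := 1 * (1 * step (c - h) t + - 2 * step c t) + 1 * step (c + h) t.

Lemma tent_ge0 c h t : 0 < h -> 0 <= tent c h t.
Proof.
move=> h0; rewrite /tent /ramp.
by case: (ltP (c - h) t) => ?; case: (ltP c t) => ?; case: (ltP (c + h) t) => ?; lra.
Qed.

Lemma tent_le c h t : 0 < h -> tent c h t <= h.
Proof.
move=> h0; rewrite /tent /ramp.
by case: (ltP (c - h) t) => ?; case: (ltP c t) => ?; case: (ltP (c + h) t) => ?; lra.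
Qed.

Lemma tent_eq0 c h t : 0 < h -> h <= `|t - c| -> tent c h t = 0.
Proof.
move=> h0; rewrite ler_normr /tent /ramp => /orP[] ?;
by case: (ltP (c - h) t) => ?; case: (ltP c t) => ?; case: (ltP (c + h) t) => ?; lra.
Qed.

Lemma is_H1_tent c h : 0 <= c - h -> 0 <= h -> c + h <= 1 -> is_H1 (tent c h) (tentd c h).
Proof.
move=> ch h0 ch1; apply: is_H1_lin.
  by apply: is_H1_lin; apply: is_H1_ramp; apply/andP; split; lra.
by apply: is_H1_ramp; apply/andP; split; lra.
Qed.

Lemma Rintegral_lin (D : set R) f g (k k' : R) : measurable D ->
  mu.-integrable D (EFin \o f) -> mu.-integrable D (EFin \o g) ->
  \int[mu]_(s in D) (k * f s + k' * g s) =
  k * \int[mu]_(s in D) f s + k' * \int[mu]_(s in D) g s.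
Proof.
move=> mD f_ g_; rewrite RintegralD ?RintegralZl//; exact: integrableZ_EFin.
Qed.

Lemma integrable_lin (D : set R) f g (k k' : R) : measurable D ->
  mu.-integrable D (EFin \o f) -> mu.-integrable D (EFin \o g) ->
  mu.-integrable D (EFin \o (fun s => k * f s + k' * g s)).
Proof.
by move=> mD f_ g_; apply: integrableD_EFin => //; exact: integrableZ_EFin.
Qed.

Lemma integral_tent c h : 0 <= c - h -> 0 <= h -> c + h <= 1 ->
  \int[mu]_(s in I01) tent c h s = h ^+ 2.
Proof.
move=> ch h0 ch1.
have [c1 c2 c3] : [/\ 0 <= c - h <= 1, 0 <= c <= 1 & 0 <= c + h <= 1].
  by split; apply/andP; split; lra.
rewrite /tent Rintegral_lin//; last 2 first.
  by apply: integrable_lin => //; exact: integrable_ramp.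
  exact: integrable_ramp.
rewrite Rintegral_lin//; [|exact: integrable_ramp..].
by rewrite !integral_ramp//; field.
Qed.

Lemma tentdM g c h : (fun s => tentd c h s * g s) =
  (fun s => 1 * (1 * (step (c - h) s * g s) + - 2 * (step c s * g s)) +
            1 * (step (c + h) s * g s)).
Proof. by apply/funext => s; rewrite /tentd; ring. Qed.

Lemma integrable_tentd f g c h : is_H1 f g ->
  mu.-integrable I01 (EFin \o (fun s => tentd c h s * g s)).
Proof.
move=> fg; rewrite tentdM; apply: integrable_lin => //.
  by apply: integrable_lin => //; exact: integrable_step fg.
exact: integrable_step fg.
Qed.

(** The slope of the tent is 1 before [c] and -1 after it, so the integral is the increment of [f]
    over the left half minus that over the right half. *)
Lemma integral_tentd f g c h : is_H1 f g -> 0 < c - h -> 0 < h -> c + h < 1 ->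
  \int[mu]_(s in I01) (tentd c h s * g s) = - diff2 f c h.
Proof.
move=> fg ch h0 ch1.
have [c1 c2 c3] : [/\ 0 <= c - h <= 1, 0 <= c <= 1 & 0 <= c + h <= 1].
  by split; apply/andP; split; lra.
rewrite tentdM Rintegral_lin//; last 2 first.
  by apply: integrable_lin => //; exact: integrable_step fg.
  exact: integrable_step fg.
rewrite Rintegral_lin//; [|exact: integrable_step fg..].
rewrite !(integral_step fg)// ?ler01 ?lexx//.
have -> : c - h < 1 by lra.
have -> : c < 1 by lra.
by rewrite ch1 /diff2; ring.
Qed.

(** The usual first variation argument: divide by [|e|], let [e] tend to 0 from either side, and the
    quadratic term disappears. *)
Lemma quadratic_nonneg_bound (X K Cc e0 : R) : 0 < e0 -> 0 <= Cc ->
  (forall e, `|e| < e0 -> 0 <= - e * X + e ^+ 2 * Cc + `|e| * K) -> `|X| <= K.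
Proof.
move=> e00 C0 H.
have key (Y : R) : (forall e, 0 < e < e0 -> 0 <= - e * Y + e ^+ 2 * Cc + e * K) -> Y <= K.
  move=> HY; rewrite leNgt; apply/negP => KY.
  (* Chosen so that [e * Cc] is smaller than [Y - K], which makes the quadratic expression
     negative. *)
  pose e := Num.min (e0 / 2) ((Y - K) / (Cc + 1) / 2).
  have C1 : 0 < Cc + 1 by lra.
  have e_gt0 : 0 < e by rewrite lt_min !divr_gt0// subr_gt0.
  have ee0 : e < e0 by rewrite gt_min; apply/orP; left; lra.
  have eY : e * (Cc + 1) <= (Y - K) / 2.
    rewrite -ler_pdivlMr// ge_min; apply/orP; right.
    by rewrite le_eqVlt; apply/orP; left; apply/eqP; field; rewrite gt_eqF.
  have := HY e; rewrite e_gt0 ee0 => /(_ isT).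
  have -> : - e * Y + e ^+ 2 * Cc + e * K = e * (e * Cc - (Y - K)) by ring.
  rewrite pmulr_rge0// => ?.
  lra.
rewrite ler_norml lerNl; apply/andP; split; apply: key => e /andP[e1 e2].
- have := H (- e); rewrite normrN gtr0_norm// => /(_ e2).
  by rewrite sqrrN; congr (0 <= _); ring.
- by have := H e; rewrite gtr0_norm// => /(_ e2).
Qed.

(** Shifting one coordinate by [e] times a tent changes the kinetic part by
    [m * (- e * diff2 + e ^+ 2 / 2 * C2)] and raises the potential part by at most
    [(e * (m * F) + m * eta * |e|) * h ^+ 2]. Minimality for small [e] of both signs then bounds
    [diff2 - h ^+ 2 * F] by [eta * h ^+ 2]. *)
Lemma jmin_schwarz Z V (j d : bool) c : jmin Z V ->
  (forall t, 0 < t < 1 -> jnocoll (conf_at Z t)) -> 0 < c < 1 ->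
  schwarz_derive (Z j d) c (force j d (conf_at Z c)).
Proof.
move=> mZ nc c01 eta eta0; have fin := jmin_finite mZ; have [aZ minZ] := mZ.
have [hZ [x10 y10 y20 x20 [x1 y1]]] := aZ.
set m := mass R j; have m0 : 0 < m by rewrite /m /mass; case: (j); rewrite ?divr_gt0 ?invr_gt0.
have me0 : 0 < m * eta by rewrite mulr_gt0.
have [rho rho0 Hrho] := jpot_increment j d (nc c c01) me0.
have : \forall t \near c, forall j' d', `|Z j' d' t - Z j' d' c| < rho.
  have n j' d' : \forall t \near c, `|Z j' d' t - Z j' d' c| < rho.
    have cZ := is_H1_continuous (hZ j' d') c01.
    have /cvgrPdist_lt/(_ _ rho0) := cZ; apply: filterS => t; rewrite distrC.
    exact.
  near=> t; case; case; near: t; exact: n.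
move=> /nbhs_ballP[de /= de0 Hde].
exists (Num.min de (Num.min c (1 - c))).
  by rewrite !lt_min de0 subr_gt0; case/andP: c01 => -> ->.
move=> h /andP[h0]; rewrite !lt_min => /andP[hde /andP[hc h1c]].
have ch : 0 < c - h by lra.
have ch1 : c + h < 1 by lra.
pose phi := tent c h; pose phid := tentd c h.
have Hphi : is_H1 phi phid by apply: is_H1_tent; lra.
pose C2 := \int[mu]_(s in I01) (phid s ^+ 2).
have C20 : 0 <= C2 by apply: Rintegral_ge0 => s _; exact: sqr_ge0.
set F := force _ _ _.
(* The tent has height [h], so [|e| < rho / h] keeps the displacement below [rho]. *)
apply: (@quadratic_nonneg_bound _ _ (C2 / 2) (rho / h)).
- by rewrite divr_gt0.
- by rewrite divr_ge0.
move=> e ee.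
have ephi t : `|e * phi t| < rho.
  rewrite normrM (ger0_norm (tent_ge0 c t h0)) (le_lt_trans (ler_wpM2l _ (tent_le c t h0)))//.
  by move: ee; rewrite ltr_pdivlMr.
pose Z' : jpath R := fun j' d' t => Z j' d' t + e * junit j d j' d' * phi t.
pose V' : jpath R := fun j' d' t => V j' d' t + e * junit j d j' d' * phid t.
have phi0 : phi 0 = 0.
  by apply: tent_eq0 => //; rewrite sub0r normrN ger0_norm; lra.
have phi1 : phi 1 = 0.
  by apply: tent_eq0 => //; rewrite ger0_norm; lra.
have aZ' : jadm Z' V'.
  split; first by move=> j' d'; apply: is_H1D => //; exact: is_H1Z.
  by rewrite /Z' phi0 phi1 !mulr0 !addr0.
pose D t := m * (e * (phid t * V j d t) + e ^+ 2 / 2 * phid t ^+ 2) +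
  (e * (m * F) + m * eta * `|e|) * phi t.
have lagD t : I01 t -> (jlag Z' V' t <= jlag Z V t + (D t)%:E)%E.
  move=> t01.
  have kE : jkin (conf_at V' t) = jkin (conf_at V t) +
      m * (e * (phid t * V j d t) + e ^+ 2 / 2 * phid t ^+ 2).
    rewrite /jkin /conf_at /V' /junit /m /mass.
    by case: (j); case: (d) => /=; field.
  have pE : (jpot (conf_at Z' t) <= jpot (conf_at Z t) +
      ((e * (m * F) + m * eta * `|e|) * phi t)%:E)%E.
    have -> : conf_at Z' t = jshift (conf_at Z t) (e * phi t) j d.
      apply/funext => j'; apply/funext => d'; rewrite /conf_at /Z' /jshift; ring.
    (* Inside the support the configuration is close to the one at [c]; outside it nothing is
       displaced. *)
    have [tc|tc] := ltP `|t - c| h.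
      have := Hrho (conf_at Z t) (e * phi t) _ (ephi t).
      rewrite normrM (ger0_norm (tent_ge0 c t h0)).
      have -> : e * phi t * (mass R j * force j d (conf_at Z c)) +
        m * eta * (`|e| * phi t) = (e * (m * F) + m * eta * `|e|) * phi t.
        by rewrite -/m -/F; ring.
      apply => j' d'; apply: Hde; rewrite /ball/= distrC; exact: lt_trans hde.
    rewrite /phi tent_eq0// !mulr0 adde0 le_eqVlt; apply/orP; left; apply/eqP.
    congr jpot; apply/funext => j'; apply/funext => d'.
    by rewrite /jshift mul0r addr0.
  rewrite /jlag kE /D; move: (jpot (conf_at Z' t)) (jpot (conf_at Z t)) pE => U' U pE.
  by rewrite EFinD [X in (_ <= _ + _ + X)%E]EFinD -!addeA leeD2l// addeCA leeD2l.
(* Finiteness of the minimal action is used here, and later to cancel it from both sides of the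
   comparison. *)
have iL : mu.-integrable I01 (jlag Z V).
  apply/integrableP; split; first exact: measurable_jlag.
  rewrite (le_lt_trans _ fin)// le_eqVlt; apply/orP; left; apply/eqP.
  by apply: eq_integral => t _; rewrite gee0_abs// jlag_ge0.
have iphid2 := is_H1_sqr_integrable Hphi.
have iphi : mu.-integrable I01 (EFin \o phi).
  apply: continuous_compact_integrable; first exact: segment_compact.
  exact: is_H1_within_continuous Hphi.
have iD : mu.-integrable I01 (EFin \o D).
  apply: integrableD_EFin => //; last exact: integrableZ_EFin.
  apply: integrableZ_EFin => //; apply: integrable_lin => //.
  exact: integrable_tentd (hZ j d).
have ID : \int[mu]_(t in I01) D t = m * (e * - diff2 (Z j d) c h + e ^+ 2 / 2 * C2) +
    (e * (m * F) + m * eta * `|e|) * h ^+ 2.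
  rewrite /D RintegralD//; last 2 first.
    apply: integrableZ_EFin => //; apply: integrable_lin => //.
    exact: integrable_tentd (hZ j d).
    exact: integrableZ_EFin.
  rewrite !RintegralZl//; last first.
    by apply: integrable_lin => //; exact: integrable_tentd (hZ j d).
  rewrite Rintegral_lin//; last exact: integrable_tentd (hZ j d).
  by rewrite (integral_tentd (hZ j d))// integral_tent//; lra.
have : (jact Z V <= jact Z V + (\int[mu]_(t in I01) D t)%:E)%E.
  apply: le_trans (minZ _ _ aZ') _.
  have -> : (jact Z V + (\int[mu]_(t in I01) D t)%:E =
    \int[mu]_(t in I01) (jlag Z V t + (D t)%:E))%E.
    rewrite integralD//; congr (_ + _)%E.
    by rewrite /Rintegral fineK//; exact: integrable_fin_num.
  apply: ge0_le_integral => //.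
  - by move=> t _; exact: jlag_ge0.
  - by apply: measurable_jlag; case: aZ'.
  - apply: emeasurable_funD; first exact: measurable_jlag.
    by case/integrableP: iD.
have Lf : jact Z V \is a fin_num by exact: integrable_fin_num.
rewrite -(fineK Lf) -EFinD lee_fin lerDl ID.
have -> : m * (e * - diff2 (Z j d) c h + e ^+ 2 / 2 * C2) +
    (e * (m * F) + m * eta * `|e|) * h ^+ 2 =
  m * (- e * (diff2 (Z j d) c h - h ^+ 2 * F) + e ^+ 2 * (C2 / 2) + `|e| * (eta * h ^+ 2)).
  by ring.
by rewrite pmulr_rge0.
Unshelve. all: by end_near. Qed.

End EulerLagrange.

(** * Newton's equations and the reflected path *)

Section Newton.
Variable R : realType.
Implicit Types (f g : R -> R) (c h t x : R) (C W : jconf R) (Z V : jpath R).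
Local Notation mu := (@lebesgue_measure R).
Local Notation I01 := `[(0:R), (1:R)]%classic.

Definition dist12 C : R := pnorm (pairv 1 0 C).
Definition dist13 C : R := pnorm (pairv (- 2^-1) 1 C).
Definition dist23 C : R := pnorm (pairv 2^-1 1 C).
Definition jdot C : R := C false false * C true false + C false true * C true true.
Definition inv3_sum C : R := (dist13 C ^+ 3)^-1 + (dist23 C ^+ 3)^-1.
Definition inv3_diff C : R := (dist13 C ^+ 3)^-1 - (dist23 C ^+ 3)^-1.
(** The divided difference of [r^(-3)] with respect to [r^2], up to sign, between the distances 13
    and 23. In this form it is continuous and positive also where the two distances agree. *)
Definition inv3_ratio C : R :=
  (dist13 C ^+ 2 + dist13 C * dist23 C + dist23 C ^+ 2) /
  ((dist13 C + dist23 C) * (dist13 C * dist23 C) ^+ 3).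

Lemma force1E d C : force false d C =
  - (2 / dist12 C ^+ 3 + inv3_sum C / 2) * C false d + inv3_diff C * C true d.
Proof.
rewrite /force /dinv_norm /inv3_sum /inv3_diff -/(dist12 C) -/(dist13 C) -/(dist23 C).
rewrite /pdot /pairv /junit /mass.
move: (dist12 C ^+ 3)^-1 (dist13 C ^+ 3)^-1 (dist23 C ^+ 3)^-1 => u v w.
by case: d => /=; field.
Qed.

Lemma force2E d C : force true d C =
  3 / 2 * (- inv3_sum C * C true d + inv3_diff C / 2 * C false d).
Proof.
rewrite /force /dinv_norm /inv3_sum /inv3_diff -/(dist12 C) -/(dist13 C) -/(dist23 C).
rewrite /pdot /pairv /junit /mass.
move: (dist12 C ^+ 3)^-1 (dist13 C ^+ 3)^-1 (dist23 C ^+ 3)^-1 => u v w.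
by case: d => /=; field.
Qed.

Lemma jnocoll_dist C : jnocoll C -> [/\ 0 < dist12 C, 0 < dist13 C & 0 < dist23 C].
Proof. by move=> [? ? ?]; split; exact: pnorm_gt0. Qed.

(** The mean of the squared distances 13 and 23 (parallelogram law). It depends on squares of
    coordinates only, so reflections preserve it. *)
Definition jquad C : R := C true false ^+ 2 + C true true ^+ 2 +
  (C false false ^+ 2 + C false true ^+ 2) / 4.

Lemma dist13_sqr C : dist13 C ^+ 2 = jquad C - jdot C.
Proof.
by rewrite /dist13 sqr_sqrtr ?pnorm2_ge0// /pnorm2 /pairv /jquad /jdot/=; field.
Qed.

Lemma dist23_sqr C : dist23 C ^+ 2 = jquad C + jdot C.
Proof.
by rewrite /dist23 sqr_sqrtr ?pnorm2_ge0// /pnorm2 /pairv /jquad /jdot/=; field.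
Qed.

(** Since the squared distances 23 and 13 differ by [2 * jdot C], the coupling in the forces becomes
    a positive factor times [jdot]; all later information about signs and linearity rests on this
    factorization. *)
Lemma inv3_diffE C : jnocoll C -> inv3_diff C = 2 * inv3_ratio C * jdot C.
Proof.
move=> /jnocoll_dist[_ r1 r2].
have E : 2 * jdot C = dist23 C ^+ 2 - dist13 C ^+ 2.
  by rewrite dist13_sqr dist23_sqr; ring.
rewrite mulrAC E /inv3_diff /inv3_ratio; field.
by rewrite !gt_eqF// addr_gt0.
Qed.

Lemma inv3_ratio_gt0 C : jnocoll C -> 0 < inv3_ratio C.
Proof.
move=> /jnocoll_dist[_ r1 r2]; rewrite divr_gt0//.
  by rewrite !addr_gt0// ?mulr_gt0// exprn_gt0.
by rewrite mulr_gt0 ?addr_gt0// exprn_gt0// mulr_gt0.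
Qed.

Section AlongPath.
Variables Z V : jpath R.
Hypothesis hZ : forall j d, is_H1 (Z j d) (V j d).
Hypothesis nc : forall t, 0 < t < 1 -> jnocoll (conf_at Z t).

Lemma continuous_coord j d t : 0 < t < 1 -> {for t, continuous (Z j d)}.
Proof. exact: is_H1_continuous. Qed.

Lemma continuous_pnorm la ka t : 0 < t < 1 ->
  {for t, continuous (fun s => pnorm (pairv la ka (conf_at Z s)))}.
Proof.
move=> t01; rewrite /pnorm /pnorm2 /pairv /conf_at /=.
apply: continuous_cvg; first exact: sqrt_continuous.
have cl d : la * Z false d x + ka * Z true d x @[x --> t] --> la * Z false d t + ka * Z true d t.
  by apply: cvgD; apply: cvgM; (exact: cvg_cst || exact: continuous_coord).
by apply: cvgD; [exact: (cvgM (cl false) (cl false))|exact: (cvgM (cl true) (cl true))].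
Qed.

Lemma continuous_inv3 la ka t : 0 < t < 1 ->
  pairv la ka (conf_at Z t) != (0, 0) ->
  {for t, continuous (fun s => (pnorm (pairv la ka (conf_at Z s)) ^+ 3)^-1)}.
Proof.
move=> t01 n0; apply: cvgV; first by rewrite expf_neq0// gt_eqF// pnorm_gt0.
have c := @continuous_pnorm la ka t t01.
exact: (cvgM c (cvgM c c)).
Qed.

Lemma continuous_inv3_sum t : 0 < t < 1 ->
  {for t, continuous (fun s => inv3_sum (conf_at Z s))}.
Proof.
move=> t01; have [n1 n2 n3] := nc t01.
by apply: cvgD; exact: continuous_inv3.
Qed.

Lemma continuous_inv3_diff t : 0 < t < 1 ->
  {for t, continuous (fun s => inv3_diff (conf_at Z s))}.
Proof.
move=> t01; have [n1 n2 n3] := nc t01.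
by apply: cvgB; exact: continuous_inv3.
Qed.

Lemma continuous_inv3_ratio t : 0 < t < 1 ->
  {for t, continuous (fun s => inv3_ratio (conf_at Z s))}.
Proof.
move=> t01; have [_ r1 r2] := jnocoll_dist (nc t01).
have c1 := @continuous_pnorm (- 2^-1) 1 t t01.
have c2 := @continuous_pnorm 2^-1 1 t t01.
have c12 : {for t, continuous (fun s => dist13 (conf_at Z s) * dist23 (conf_at Z s))}.
  exact: (cvgM c1 c2).
apply: cvgM.
  apply: cvgD; last exact: (cvgM c2 c2).
  by apply: cvgD; [exact: (cvgM c1 c1)|exact: c12].
apply: cvgV.
  by rewrite mulf_neq0 ?expf_neq0 ?mulf_neq0// gt_eqF// addr_gt0.
by apply: cvgM; [exact: (cvgD c1 c2)|exact: (cvgM c12 (cvgM c12 c12))].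
Qed.

Lemma continuous_stiffness1 t : 0 < t < 1 ->
  {for t, continuous (fun s => - (2 / dist12 (conf_at Z s) ^+ 3 + inv3_sum (conf_at Z s) / 2))}.
Proof.
move=> t01; have [n1 _ _] := nc t01; apply: cvgN; apply: cvgD.
  by apply: cvgM; [exact: cvg_cst|exact: continuous_inv3].
by apply: cvgM; [exact: continuous_inv3_sum|exact: cvg_cst].
Qed.

Lemma continuous_force j d t : 0 < t < 1 ->
  {for t, continuous (fun s => force j d (conf_at Z s))}.
Proof.
move=> t01; case: j.
  rewrite (_ : (fun s => _) = fun s => 3 / 2 * (- inv3_sum (conf_at Z s) * Z true d s +
    inv3_diff (conf_at Z s) / 2 * Z false d s)); last first.
    by apply/funext => s; rewrite force2E.
  apply: cvgM; first exact: cvg_cst.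
  apply: cvgD; apply: cvgM; try exact: continuous_coord.
    by apply: cvgN; exact: continuous_inv3_sum.
  by apply: cvgM; [exact: continuous_inv3_diff|exact: cvg_cst].
rewrite (_ : (fun s => _) = fun s => - (2 / dist12 (conf_at Z s) ^+ 3 +
  inv3_sum (conf_at Z s) / 2) * Z false d s + inv3_diff (conf_at Z s) * Z true d s); last first.
  by apply/funext => s; rewrite force1E.
apply: cvgD; apply: cvgM; try exact: continuous_coord.
  exact: continuous_stiffness1.
exact: continuous_inv3_diff.
Qed.

End AlongPath.

Lemma jmin_newton Z V : jmin Z V -> (forall t, 0 < t < 1 -> jnocoll (conf_at Z t)) ->
  forall j d t, 0 < t < 1 -> is_derive t 1 (Z j d) (derive1 (Z j d) t) /\
    is_derive t 1 (derive1 (Z j d)) (force j d (conf_at Z t)).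
Proof.
move=> mZ nc j d; have [[hZ _] _] := mZ.
apply: schwarz_derive_is_derive2.
- by move=> t; exact: is_H1_continuous (hZ j d).
- by move=> t; exact: continuous_force hZ nc j d t.
- by move=> t; exact: jmin_schwarz mZ nc.
Qed.

Definition tsign (j d : bool) : R := if j && d then -1 else 1.
Definition tilde_conf C : jconf R := fun j d => tsign j d * `|C j d|.
Definition tilde Z : jpath R := fun j d t => tsign j d * `|Z j d t|.
Definition tilde_deriv Z V : jpath R :=
  fun j d t => tsign j d * (Num.sg (Z j d t) * V j d t).

Lemma tsign_sqr j d : tsign j d ^+ 2 = 1.
Proof. by rewrite /tsign; case: (j && d); rewrite ?sqrrN expr1n. Qed.

Lemma tilde_conf_sqr C j d : tilde_conf C j d ^+ 2 = C j d ^+ 2.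
Proof. by rewrite exprMn tsign_sqr mul1r real_normK ?num_real. Qed.

Lemma jquad_tilde C : jquad (tilde_conf C) = jquad C.
Proof. by rewrite /jquad !tilde_conf_sqr. Qed.

Lemma dist12_tilde C : dist12 (tilde_conf C) = dist12 C.
Proof.
rewrite /dist12 /pnorm /pnorm2 /pairv/= !mul1r !mul0r !addr0.
by rewrite !tilde_conf_sqr.
Qed.

(** After the reflection the two products in [jdot] have opposite signs, so this is the reverse
    triangle inequality. *)
Lemma jdot_tilde C : `|jdot (tilde_conf C)| <= `|jdot C|.
Proof.
rewrite /jdot /tilde_conf /tsign/= !mul1r mulN1r mulrN -!normrM.
have := ler_dist_dist (C false false * C true false) (- (C false true * C true true)).
by rewrite normrN opprK.
Qed.

(** The squared product of the two distances is [jquad ^+ 2 - jdot ^+ 2]. *)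
Lemma dist_prod_tilde C :
  (dist13 C * dist23 C) ^+ 2 <= (dist13 (tilde_conf C) * dist23 (tilde_conf C)) ^+ 2.
Proof.
rewrite !exprMn !dist13_sqr !dist23_sqr jquad_tilde.
have : jdot (tilde_conf C) ^+ 2 <= jdot C ^+ 2.
  rewrite -[leLHS]real_normK ?num_real// -[leRHS]real_normK ?num_real//.
  by rewrite lerXn2r ?nnegrE// jdot_tilde.
nra.
Qed.

Lemma pnorm_eq0 (z : pt R) : (pnorm z == 0) = (z == (0, 0)).
Proof. by rewrite /pnorm sqrtr_eq0 -pnorm2_eq0 eq_le pnorm2_ge0 andbT. Qed.

Lemma jnocoll_tilde C : jnocoll C -> jnocoll (tilde_conf C).
Proof.
move=> nC; have [r0 r1 r2] := jnocoll_dist nC.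
have P : 0 < (dist13 (tilde_conf C) * dist23 (tilde_conf C)) ^+ 2.
  by apply: lt_le_trans (dist_prod_tilde C); rewrite exprn_gt0// mulr_gt0.
have : dist13 (tilde_conf C) * dist23 (tilde_conf C) != 0.
  by rewrite -sqrf_eq0 gt_eqF.
rewrite mulf_eq0 negb_or => /andP[p1 p2].
split; rewrite -pnorm_eq0//.
by rewrite -/(dist12 (tilde_conf C)) dist12_tilde gt_eqF.
Qed.

Lemma jpot_nocoll C : jnocoll C ->
  jpot C = ((dist12 C)^-1 + ((dist13 C)^-1 + (dist23 C)^-1))%:E.
Proof.
by move=> [n1 n2 n3]; rewrite /jpot /inv_norm !ifN// -!EFinD addrA.
Qed.

Lemma jpot_coll C : ~ jnocoll C -> jpot C = +oo%E.
Proof.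
move=> nC; rewrite /jpot.
have nNy (z : pt R) : inv_norm z != -oo%E.
  by rewrite gt_eqF// (lt_le_trans _ (inv_norm_ge0 z)).
have [n1|n1] := eqVneq (pairv 1 0 C) (0, 0).
  by rewrite {1}/inv_norm n1 eqxx -addeA addye// adde_eq_ninfty negb_or !nNy.
have [n2|n2] := eqVneq (pairv (- 2^-1) 1 C) (0, 0).
  by rewrite {2}/inv_norm n2 eqxx addey// addye.
have [n3|n3] := eqVneq (pairv 2^-1 1 C) (0, 0).
  by rewrite {3}/inv_norm n3 eqxx addey// adde_eq_ninfty negb_or !nNy.
by exfalso; apply: nC.
Qed.

(* [(1/r13 + 1/r23)^2 = (r13^2 + r23^2)/(r13 r23)^2 + 2/(r13 r23)], and
   [r13^2 + r23^2] is not affected by the reflections. *)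
Lemma jpot_tilde C : (jpot (tilde_conf C) <= jpot C)%E.
Proof.
have [nC|nC] := pselect (jnocoll C); last by rewrite (jpot_coll nC) leey.
have nT := jnocoll_tilde nC; rewrite !jpot_nocoll// lee_fin dist12_tilde lerD2l.
have [_ r1 r2] := jnocoll_dist nC; have [_ s1 s2] := jnocoll_dist nT.
have P : dist13 C * dist23 C <= dist13 (tilde_conf C) * dist23 (tilde_conf C).
  by rewrite -(@ler_pXn2r _ 2)// ?nnegrE ?dist_prod_tilde// mulr_ge0// ltW.
have sq : dist13 (tilde_conf C) ^+ 2 + dist23 (tilde_conf C) ^+ 2 =
    dist13 C ^+ 2 + dist23 C ^+ 2.
  by rewrite !dist13_sqr !dist23_sqr jquad_tilde; ring.
rewrite -(@ler_pXn2r _ 2)// ?nnegrE ?addr_ge0 ?invr_ge0 ?(ltW r1) ?(ltW r2) ?(ltW s1) ?(ltW s2)//.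
have E (a b : R) : 0 < a -> 0 < b ->
    (a^-1 + b^-1) ^+ 2 = (a ^+ 2 + b ^+ 2) * (a * b)^-1 ^+ 2 + 2 * (a * b)^-1.
  by move=> a0 b0; field; rewrite !gt_eqF.
rewrite !E// sq.
have I : (dist13 (tilde_conf C) * dist23 (tilde_conf C))^-1 <= (dist13 C * dist23 C)^-1.
  by rewrite lef_pV2 ?posrE ?mulr_gt0.
apply: lerD; last by rewrite ler_wpM2l.
rewrite ler_wpM2l ?addr_ge0 ?sqr_ge0//.
by rewrite lerXn2r ?nnegrE ?invr_ge0 ?mulr_ge0 ?(ltW r1) ?(ltW r2) ?(ltW s1) ?(ltW s2).
Qed.

(** The signs assumed at time 1 make [tilde Z] agree there with [Z], so the end relations survive;
    at time 0 only [Z2x], already nonnegative, can be nonzero. The kinetic energy does not grow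
    because [|sg| <= 1]. *)
Lemma jmin_tilde Z V : jmin Z V -> (forall t, 0 < t < 1 -> jnocoll (conf_at Z t)) ->
  0 <= Z false false 1 -> 0 <= Z false true 1 -> Z true true 1 <= 0 ->
  jmin (tilde Z) (tilde_deriv Z V).
Proof.
move=> mZ nc X1 Y1 Y2; have [[hZ [x10 y10 y20 x20 [x1 y1]]] minZ] := mZ.
have N := jmin_newton mZ nc.
have aT : jadm (tilde Z) (tilde_deriv Z V).
  split.
    move=> j d.
    have D1 t : 0 < t < 1 -> is_derive t 1 (Z j d) (derive1 (Z j d) t).
      by move=> t01; case: (N j d t t01).
    have D2 t : 0 < t < 1 -> {for t, continuous (derive1 (Z j d))}.
      by move=> t01; have [_ D] := N j d t t01; exact: is_derive1_continuous D.
    exact: (is_H1Z (tsign j d) (is_H1_abs (hZ j d) D1 D2)).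
  rewrite /tilde /tsign/= !mul1r !mulN1r x10 y10 y20 normr0 oppr0; split => //.
  split; first by rewrite x1 normrM ger0_norm// divr_ge0.
  by rewrite (ger0_norm Y1) (ler0_norm Y2) opprK.
split => // Z' V' aZ'; apply: le_trans (minZ _ _ aZ').
apply: ge0_le_integral => //.
- by move=> t _; exact: jlag_ge0.
- by apply: measurable_jlag; case: aT.
- exact: measurable_jlag.
move=> t _; rewrite /jlag; apply: leeD; last exact: jpot_tilde.
have sq j d : tilde_deriv Z V j d t ^+ 2 <= V j d t ^+ 2.
  rewrite exprMn tsign_sqr mul1r exprMn ler_piMl ?sqr_ge0//.
  by rewrite -real_normK ?num_real// normr_sg expr_le1//; case: (Z j d t != 0).
rewrite lee_fin /jkin /conf_at /mass.
have := sq false false; have := sq false true; have := sq true false; have := sq true true.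
lra.
Qed.

Lemma schwarz_deriveZ (k : R) f c l :
  schwarz_derive f c l -> schwarz_derive (fun x => k * f x) c (k * l).
Proof.
move=> sf eta eta0.
have e0 : 0 < eta / (`|k| + 1) by rewrite divr_gt0// ltr_wpDl.
have [h0 h00 H] := sf _ e0; exists h0 => // h hh.
have -> : diff2 (fun x => k * f x) c h - h ^+ 2 * (k * l) = k * (diff2 f c h - h ^+ 2 * l).
  by rewrite /diff2; ring.
rewrite normrM (le_trans (ler_wpM2l _ (H h hh)))// mulrA ler_wpM2r ?sqr_ge0//.
rewrite mulrA ler_pdivrMr ?ltr_wpDl// mulrC ler_wpM2l ?(ltW eta0)//.
by rewrite lerDl.
Qed.

Lemma schwarz_derive_sgM f c l : {for c, continuous f} -> f c != 0 ->
  schwarz_derive f c l -> schwarz_derive (fun x => `|f x|) c (Num.sg (f c) * l).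
Proof.
move=> cf fc sf eta eta0.
have [h0 h00 H] := schwarz_deriveZ (Num.sg (f c)) sf eta0.
have : \forall x \near c, `|f x| = Num.sg (f c) * f x.
  have [fp|fn|f0] := ltgtP 0 (f c); last by rewrite -f0 eqxx in fc.
  - have n : \forall x \near c, 0 < f x by exact: cvgr_gt cf _ fp.
    by apply: filterS n => x fx; rewrite gtr0_norm// gtr0_sg// mul1r.
  - have n : \forall x \near c, f x < 0 by exact: cvgr_lt cf _ fn.
    by apply: filterS n => x fx; rewrite ltr0_norm// ltr0_sg// mulN1r.
move=> /nbhs_ballP[d /= d0 E].
exists (Num.min h0 d); first by rewrite lt_min h00.
move=> h /andP[hh0]; rewrite lt_min => /andP[hh1 hd].
have := H h; rewrite hh0 hh1 => /(_ isT).
rewrite /diff2 -!E//; first exact: ballxx.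
- by rewrite /ball/= opprB addrC subrK gtr0_norm.
- by rewrite /ball/= opprD addrA subrr sub0r normrN gtr0_norm.
Qed.

End Newton.

(** * Common zeros, signs and quadrants *)

Section Quadrants.
Variable R : realType.
Implicit Types (c t : R).
Variables Z V : jpath R.
Hypothesis mZ : jmin Z V.
Hypothesis nc : forall t, 0 < t < 1 -> jnocoll (conf_at Z t).
Hypothesis Z2x0 : 0 < Z true false 0.
Hypothesis Z1x1 : 0 < Z false false 1.
Hypothesis Z1y1 : 0 <= Z false true 1.
Hypothesis Z2y1 : Z true true 1 <= 0.

Let hZ : forall j d, is_H1 (Z j d) (V j d).
Proof. by case: mZ => -[]. Qed.

Let N j d t (t01 : 0 < t < 1) := jmin_newton mZ nc j d t01.

Let mT : jmin (tilde Z) (tilde_deriv Z V).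
Proof. by apply: jmin_tilde => //; exact: ltW. Qed.

Let ncT t : 0 < t < 1 -> jnocoll (conf_at (tilde Z) t).
Proof. by move=> t01; exact: jnocoll_tilde (nc t01). Qed.

(* A transversal zero would be a corner of the minimizing path [tilde Z]. *)
Lemma derive_zero_coord j d c : 0 < c < 1 -> Z j d c = 0 -> derive1 (Z j d) c = 0.
Proof.
move=> c01 Zc; have [D _] := N j d c01.
have S := schwarz_deriveZ (tsign R j d) (jmin_schwarz j d mT ncT c01).
apply: (norm_schwarz_derive_kink D Zc).
suff E : (fun x => `|Z j d x|) = (fun x => tsign R j d * tilde Z j d x).
  by rewrite E; exact: S.
by apply/funext => x; rewrite /tilde mulrA -expr2 tsign_sqr mul1r.
Qed.

(** If two coordinates have forces linear in themselves and vanish at [c], their derivatives vanish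
    there too by [derive_zero_coord], so uniqueness for the linear system kills both on (0,1), and
    continuity on [0,1]. *)
Lemma pair_vanish j d j' d' (a11 a12 a21 a22 : R -> R) c :
  (forall t, 0 < t < 1 -> force j d (conf_at Z t) = a11 t * Z j d t + a12 t * Z j' d' t) ->
  (forall t, 0 < t < 1 -> force j' d' (conf_at Z t) = a21 t * Z j d t + a22 t * Z j' d' t) ->
  (forall t, 0 < t < 1 -> {for t, continuous a11}) ->
  (forall t, 0 < t < 1 -> {for t, continuous a12}) ->
  (forall t, 0 < t < 1 -> {for t, continuous a21}) ->
  (forall t, 0 < t < 1 -> {for t, continuous a22}) ->
  0 < c < 1 -> Z j d c = 0 -> Z j' d' c = 0 ->
  forall t, 0 <= t <= 1 -> Z j d t = 0 /\ Z j' d' t = 0.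
Proof.
move=> E1 E2 c11 c12 c21 c22 c01 z z'.
have H : forall t, 0 < t < 1 -> Z j d t = 0 /\ Z j' d' t = 0.
  apply: (@linear_system_unique _ _ (derive1 (Z j d)) _ (derive1 (Z j' d'))
    a11 a12 a21 a22 c) => //.
  - by move=> t t01; case: (N j d t01).
  - by move=> t t01; case: (N j' d' t01).
  - by move=> t t01; rewrite -E1//; case: (N j d t01).
  - by move=> t t01; rewrite -E2//; case: (N j' d' t01).
  - exact: derive_zero_coord.
  - exact: derive_zero_coord.
move=> t t01; split.
- by apply: (cvg_within01_eq (is_H1_within_continuous (hZ j d))) t01 => s /H[].
- by apply: (cvg_within01_eq (is_H1_within_continuous (hZ j' d'))) t01 => s /H[].
Qed.

Let cZ j d t : 0 < t < 1 -> {for t, continuous (Z j d)}.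
Proof. exact: continuous_coord hZ j d t. Qed.

Let cS t : 0 < t < 1 -> {for t, continuous (fun s => inv3_sum (conf_at Z s))}.
Proof. exact: continuous_inv3_sum hZ nc t. Qed.

Let cD t : 0 < t < 1 -> {for t, continuous (fun s => inv3_diff (conf_at Z s))}.
Proof. exact: continuous_inv3_diff hZ nc t. Qed.

Let cK t : 0 < t < 1 -> {for t, continuous (fun s => inv3_ratio (conf_at Z s))}.
Proof. exact: continuous_inv3_ratio hZ nc t. Qed.

Let stiff t := - (2 / dist12 (conf_at Z t) ^+ 3 + inv3_sum (conf_at Z t) / 2).

Let cst1 t : 0 < t < 1 -> {for t, continuous stiff}.
Proof. exact: continuous_stiffness1 hZ nc t. Qed.

(** Collinear configurations along a coordinate axis are invariant: the [d]-components of the forces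
    involve only the [d]-coordinates, with scalar coefficients. *)
Lemma vanish_axis d c : 0 < c < 1 -> Z false d c = 0 -> Z true d c = 0 ->
  forall t, 0 <= t <= 1 -> Z false d t = 0 /\ Z true d t = 0.
Proof.
apply: (@pair_vanish false d true d stiff (fun s => inv3_diff (conf_at Z s))
  (fun s => 3 / 4 * inv3_diff (conf_at Z s)) (fun s => - (3 / 2) * inv3_sum (conf_at Z s))).
- by move=> t t01; rewrite force1E.
- by move=> t t01; rewrite force2E /conf_at; field.
- exact: cst1.
- exact: cD.
- by move=> t t01; apply: cvgM; [exact: cvg_cst|exact: cD].
- by move=> t t01; apply: cvgM; [exact: cvg_cst|exact: cS].
Qed.

Let jdotE d t : jdot (conf_at Z t) =
  Z false d t * Z true d t + Z false (~~ d) t * Z true (~~ d) t.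
Proof. by case: d; rewrite /jdot /conf_at//= addrC. Qed.

(** Isosceles configurations, with [Z1] along one axis and [Z2] along the other, are invariant. Each
    product in [jdot] contains one of the two vanishing coordinates, so [inv3_diffE] makes the
    forces linear in them. *)
Lemma vanish_isosceles d c : 0 < c < 1 -> Z false d c = 0 -> Z true (~~ d) c = 0 ->
  forall t, 0 <= t <= 1 -> Z false d t = 0 /\ Z true (~~ d) t = 0.
Proof.
pose K s := inv3_ratio (conf_at Z s).
apply: (@pair_vanish false d true (~~ d)
  (fun s => stiff s + 2 * K s * (Z true d s * Z true d s))
  (fun s => 2 * K s * (Z false (~~ d) s * Z true d s))
  (fun s => 3 / 2 * K s * (Z true d s * Z false (~~ d) s))
  (fun s => 3 / 2 * (- inv3_sum (conf_at Z s) + K s * (Z false (~~ d) s * Z false (~~ d) s)))).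
- move=> t t01; rewrite force1E inv3_diffE ?(jdotE d)//; last exact: nc.
  by rewrite -/(stiff t) -/(K t) /conf_at; ring.
- move=> t t01; rewrite force2E inv3_diffE ?(jdotE d)//; last exact: nc.
  by rewrite -/(K t) /conf_at; field.
- move=> t t01; apply: cvgD; first exact: cst1.
  apply: cvgM; last exact: (cvgM (cZ t01) (cZ t01)).
  by apply: cvgM; [exact: cvg_cst|exact: cK].
- move=> t t01; apply: cvgM; last exact: (cvgM (cZ t01) (cZ t01)).
  by apply: cvgM; [exact: cvg_cst|exact: cK].
- move=> t t01; apply: cvgM; last exact: (cvgM (cZ t01) (cZ t01)).
  by apply: cvgM; [exact: cvg_cst|exact: cK].
- move=> t t01; apply: cvgM; first exact: cvg_cst.
  apply: cvgD; first by apply: cvgN; exact: cS.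
  by apply: cvgM; [exact: cK|exact: (cvgM (cZ t01) (cZ t01))].
Qed.

(** Configurations with body 3 at the midpoint of the other two are invariant, because [jdot] is
    linear in [Z2]. *)
Lemma vanish_center c : 0 < c < 1 -> Z true false c = 0 -> Z true true c = 0 ->
  forall t, 0 <= t <= 1 -> Z true false t = 0 /\ Z true true t = 0.
Proof.
pose K s := inv3_ratio (conf_at Z s).
pose a d s := 3 / 2 * (- inv3_sum (conf_at Z s) + K s * (Z false d s * Z false d s)).
pose b s := 3 / 2 * K s * (Z false false s * Z false true s).
have ca d t : 0 < t < 1 -> {for t, continuous (a d)}.
  move=> t01; apply: cvgM; first exact: cvg_cst.
  apply: cvgD; first by apply: cvgN; exact: cS.
  by apply: cvgM; [exact: cK|exact: (cvgM (cZ t01) (cZ t01))].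
have cb t : 0 < t < 1 -> {for t, continuous b}.
  move=> t01; apply: cvgM; last exact: (cvgM (cZ t01) (cZ t01)).
  by apply: cvgM; [exact: cvg_cst|exact: cK].
apply: (@pair_vanish true false true true (a false) b b (a true)) => //.
- move=> t t01; rewrite force2E inv3_diffE; last exact: nc.
  by rewrite (jdotE false) /a /b -/(K t) /conf_at/=; field.
- move=> t t01; rewrite force2E inv3_diffE; last exact: nc.
  by rewrite (jdotE false) /a /b -/(K t) /conf_at/=; field.
- exact: ca.
- exact: ca.
Qed.

(** When one coordinate vanishes, its acceleration reduces to a positive multiple of the product of
    the other three, so it is nonzero and the second derivative test applies. *)
Lemma touching_coord j d c : 0 < c < 1 -> Z j d c = 0 ->
  Z j (~~ d) c != 0 -> Z (~~ j) d c != 0 -> Z (~~ j) (~~ d) c != 0 ->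
  isolated_touching_zero (Z j d) c.
Proof.
move=> c01 z n1 n2 n3; have [_ D] := N j d c01.
apply: (@touching_zero _ (Z j d) (derive1 (Z j d)) c _ c01 _ D z).
- by move=> t t01; case: (N j d t01).
- exact: derive_zero_coord.
have K0 : inv3_ratio (conf_at Z c) != 0 by rewrite gt_eqF// inv3_ratio_gt0//; exact: nc.
have CE j' d' : conf_at Z c j' d' = Z j' d' c by [].
case: j z n1 n2 n3 {D} => /= z n1 n2 n3.
  rewrite force2E inv3_diffE; last exact: nc.
  move: (inv3_ratio _) K0 => k k0.
  by rewrite (jdotE d) !CE z !mulr0 !add0r !mulf_neq0 ?invr_eq0 ?pnatr_eq0.
rewrite force1E inv3_diffE; last exact: nc.
move: (inv3_ratio _) K0 => k k0.
by rewrite (jdotE d) !CE z mul0r mulr0 !add0r !mulf_neq0 ?pnatr_eq0.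
Qed.

(** Among the six pairs of coordinates, five cannot vanish together in (0,1): [Z1x] with [Z1y] would
    be a collision, and the other four contradict [Z2x(0) > 0] or [Z1x(1) > 0]. *)
Let neq_1x_2x c : 0 < c < 1 -> Z false false c = 0 -> Z true false c = 0 -> False.
Proof.
move=> c01 z z'; have [|_ e] := vanish_axis c01 z z' (t := 0).
  by rewrite lexx ler01.
by move: Z2x0; rewrite e ltxx.
Qed.

Let neq_1x_2y c : 0 < c < 1 -> Z false false c = 0 -> Z true true c = 0 -> False.
Proof.
move=> c01 z z'; have [|e _] := vanish_isosceles c01 z z' (t := 1).
  by rewrite lexx ler01.
by move: Z1x1; rewrite e ltxx.
Qed.

Let neq_1y_2x c : 0 < c < 1 -> Z false true c = 0 -> Z true false c = 0 -> False.
Proof.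
move=> c01 z z'; have [|_ e] := @vanish_isosceles true c c01 z z' 0.
  by rewrite lexx ler01.
by move: Z2x0; rewrite e ltxx.
Qed.

Let neq_2x_2y c : 0 < c < 1 -> Z true false c = 0 -> Z true true c = 0 -> False.
Proof.
move=> c01 z z'; have [|e _] := vanish_center c01 z z' (t := 0).
  by rewrite lexx ler01.
by move: Z2x0; rewrite e ltxx.
Qed.

Let neq_1x_1y c : 0 < c < 1 -> Z false false c = 0 -> Z false true c = 0 -> False.
Proof.
move=> c01 z z'; have [n1 _ _] := nc c01.
by move: n1; rewrite /pairv /conf_at z z' !mul0r !mulr0 !addr0 eqxx.
Qed.

Lemma touching_x j c : 0 < c < 1 -> Z j false c = 0 ->
  isolated_touching_zero (Z j false) c.
Proof.
move=> c01; case: j => z; apply: touching_coord => //=; apply/eqP => z'.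
- exact: neq_2x_2y z z'.
- exact: neq_1x_2x z' z.
- exact: neq_1y_2x z' z.
- exact: neq_1x_1y z z'.
- exact: neq_1x_2x z z'.
- exact: neq_1x_2y z z'.
Qed.

(** The remaining pair, [Z1y] with [Z2y], corresponds to motion on the x-axis, which the end
    conditions allow; it is kept as a separate alternative. *)
Lemma touching_y : (forall t, 0 <= t <= 1 -> Z false true t = 0 /\ Z true true t = 0) \/
  (forall j c, 0 < c < 1 -> Z j true c = 0 -> isolated_touching_zero (Z j true) c).
Proof.
have [[c [c01 z z']]|nz] :=
  pselect (exists c, [/\ 0 < c < 1, Z false true c = 0 & Z true true c = 0]).
  by left; exact: vanish_axis c01 z z'.
right => j c c01; case: j => z; apply: touching_coord => //=; apply/eqP => z'.
- exact: neq_2x_2y z' z.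
- by apply: nz; exists c.
- exact: neq_1x_2y z' z.
- exact: neq_1x_1y z' z.
- by apply: nz; exists c.
- exact: neq_1y_2x z z'.
Qed.

Let Z2x1 : Z true false 1 = 3 / 2 * Z false false 1.
Proof. by case: mZ => -[_ [_ _ _ _ []]]. Qed.

Lemma x_coords_ge0 j t : 0 <= t <= 1 -> 0 <= Z j false t.
Proof.
have p1 : 0 < Z j false 1 by case: j => //; rewrite Z2x1 mulr_gt0// divr_gt0.
have [H|H] := constant_sign (is_H1_within_continuous (hZ j false)) (touching_x (j := j)).
  exact: H.
by have := H 1; rewrite ler01 lexx leNgt p1 => /(_ isT).
Qed.

(** Primes refer to the reflected configuration. The equations reduce to
    [(S - S') x1 = 2 (T - T') x2] and [2 (S - S') x2 = (T - T') x1], and the same in [y] with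
    [T + T']. If [S = S'], both [T - T'] and [T + T'] vanish; otherwise eliminating them leaves
    [x1 ^+ 2 = 4 x2 ^+ 2] and [y1 ^+ 2 = 4 y2 ^+ 2]. *)
Lemma reflected_forces_eq (u S S' T T' x1 x2 y1 y2 : R) :
  0 < x1 -> 0 < x2 -> 0 < y1 -> 0 < y2 ->
  - (u + S' / 2) * x1 + T' * x2 = - (u + S / 2) * x1 + T * x2 ->
  - (u + S' / 2) * y1 + T' * - y2 = - (u + S / 2) * y1 + T * y2 ->
  - S' * x2 + T' / 2 * x1 = - S * x2 + T / 2 * x1 ->
  - S' * - y2 + T' / 2 * y1 = - (- S * y2 + T / 2 * y1) ->
  (x1 = 2 * x2 /\ y1 = 2 * y2) \/ T = 0.
Proof.
move=> x10 x20 y10 y20 e1 e2 e3 e4.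
have [D0|D0] := eqVneq (S - S') 0.
  right.
  have : (T - T') * x2 = 0 by nra.
  have : (T + T') * y2 = 0 by nra.
  move=> /eqP; rewrite mulf_eq0 (gt_eqF y20) orbF => /eqP h1.
  move=> /eqP; rewrite mulf_eq0 (gt_eqF x20) orbF => /eqP h2.
  lra.
left.
have q (a b : R) : 0 < a -> 0 < b -> (S - S') * (a * a - 4 * (b * b)) = 0 -> a = 2 * b.
  move=> a0 b0 /eqP; rewrite mulf_eq0 (negbTE D0)/= => /eqP h.
  have : (a - 2 * b) * (a + 2 * b) = 0 by rewrite -[RHS]h; ring.
  move=> /eqP; rewrite mulf_eq0 => /orP[/eqP|/eqP]; lra.
split; apply: q => //.
- have f1 : (S - S') * x1 = 2 * ((T - T') * x2) by lra.
  have f3 : (S - S') * (2 * x2) = (T - T') * x1 by lra.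
  have -> : (S - S') * (x1 * x1 - 4 * (x2 * x2)) =
    ((S - S') * x1) * x1 - 2 * x2 * ((S - S') * (2 * x2)) by ring.
  by rewrite f1 f3; ring.
- have f1 : (S - S') * y1 = 2 * ((T + T') * y2) by lra.
  have f3 : (S - S') * (2 * y2) = (T + T') * y1 by lra.
  have -> : (S - S') * (y1 * y1 - 4 * (y2 * y2)) =
    ((S - S') * y1) * y1 - 2 * y2 * ((S - S') * (2 * y2)) by ring.
  by rewrite f1 f3; ring.
Qed.

(** Both paths are minimizers, so a coordinate of [tilde Z] has two symmetric second derivatives at
    [t]: the force of the reflected configuration and the reflected force. *)
Lemma force_tilde j d t : 0 < t < 1 -> Z j d t != 0 ->
  force j d (tilde_conf (conf_at Z t)) =
  tsign R j d * (Num.sg (Z j d t) * force j d (conf_at Z t)).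
Proof.
move=> t01 z; apply: (@schwarz_derive_unique _ (tilde Z j d) t).
  exact: jmin_schwarz mT ncT t01.
apply: schwarz_deriveZ; apply: schwarz_derive_sgM => //; first exact: cZ.
exact: jmin_schwarz mZ nc t01.
Qed.

(* Both [Z] and [tilde Z] satisfy Newton's equations; if [tilde Z] only differs
   from [Z] by a reflection of the y-coordinate of one Jacobi vector, this forces
   a collision of bodies 1 and 3, or [jdot = 0]. *)
Lemma y_coords_opposite t : 0 < t < 1 -> 0 < Z false false t -> 0 < Z true false t ->
  Z false true t * Z true true t <= 0.
Proof.
move=> t01 x1 x2; rewrite leNgt; apply/negP => yy.
have y1n : Z false true t != 0 by apply: contraTneq yy => ->; rewrite mul0r ltxx.
have y2n : Z true true t != 0 by apply: contraTneq yy => ->; rewrite mulr0 ltxx.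
have sg12 : Num.sg (Z true true t) = Num.sg (Z false true t).
  have : Num.sg (Z false true t) * Num.sg (Z true true t) = 1 by rewrite -sgrM gtr0_sg.
  move: (Z false true t) (Z true true t) y1n y2n => y1 y2 y1n y2n.
  case: sgrP y1n => // _ _; case: sgrP y2n => // _ _; rewrite ?mulN1r ?mul1r ?mulrN1; lra.
have e1 := force_tilde t01 (lt0r_neq0 x1).
have e2 := force_tilde t01 (lt0r_neq0 x2).
have e3 := force_tilde t01 y1n.
have e4 := force_tilde t01 y2n.
move: e1 e2 e3 e4.
rewrite !force1E !force2E dist12_tilde /tsign/= (gtr0_sg x1) (gtr0_sg x2) sg12 !mul1r.
set C := conf_at Z t.
set S := inv3_sum C; set S' := inv3_sum (tilde_conf C).
set T := inv3_diff C; set T' := inv3_diff (tilde_conf C).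
set u := 2 / dist12 C ^+ 3.
have tE j d : tilde_conf C j d = tsign R j d * `|Z j d t| by [].
have CE j d : C j d = Z j d t by [].
rewrite !tE !CE /tsign/= !mul1r !mulN1r (gtr0_norm x1) (gtr0_norm x2).
set s := Num.sg (Z false true t).
have s1 : s * Z false true t = `|Z false true t| by rewrite normrEsg.
have s2 : s * Z true true t = `|Z true true t| by rewrite normrEsg sg12.
move=> e1 e2 e3 e4.
have e3' : - (u + S' / 2) * `|Z false true t| + T' * - `|Z true true t| =
    - (u + S / 2) * `|Z false true t| + T * `|Z true true t|.
  by rewrite e3 -s1 -s2; ring.
have h32 : 3 / 2 != 0 :> R by rewrite mulf_neq0// invr_eq0.
have e2' := mulfI h32 e2.
have e4' : - S' * - `|Z true true t| + T' / 2 * `|Z false true t| =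
    - (- S * `|Z true true t| + T / 2 * `|Z false true t|).
  apply: (mulfI h32); rewrite e4 -s1 -s2; ring.
have p1 : 0 < `|Z false true t| by rewrite normr_gt0.
have p2 : 0 < `|Z true true t| by rewrite normr_gt0.
have [_ n2 _] := nc t01.
have [[f1 f2]|T0] := reflected_forces_eq x1 x2 p1 p2 e1 e3' e2' e4'.
  have s0 : s != 0 by rewrite sgr_eq0.
  have f2' : Z false true t = 2 * Z true true t.
    by apply: (mulfI s0); rewrite mulrCA s1 s2.
  move: n2; rewrite /pairv /conf_at f1 f2' xpair_eqE; apply/negP; rewrite negbK.
  by apply/andP; split; apply/eqP; field.
have := inv3_diffE (nc t01); rewrite -/C -/T T0 => /esym/eqP.
rewrite mulf_eq0 mulf_eq0 pnatr_eq0/= (gt_eqF (inv3_ratio_gt0 (nc t01)))/=.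
by rewrite /jdot gt_eqF// addr_gt0// mulr_gt0.
Qed.

(** Each y-coordinate has a constant sign, so it suffices to know that the signs are opposite at one
    time where no coordinate vanishes. *)
Lemma minimizer_y_signs :
  (forall t, 0 <= t <= 1 -> 0 <= Z false true t /\ Z true true t <= 0) \/
  (forall t, 0 <= t <= 1 -> Z false true t <= 0 /\ 0 <= Z true true t).
Proof.
have [H|ty] := touching_y.
  by left => t /H[-> ->].
have oo j d t : 0 < t < 1 -> {for t, continuous (Z j d)} by exact: cZ.
have h0 : 0 < 3^-1 :> R by rewrite invr_gt0.
have h1 : 2^-1 < 1 :> R by rewrite invf_lt1// ltr1n.
have h01 : 3^-1 < 2^-1 :> R by rewrite ltf_pV2 ?posrE// ltr_nat.
(* Four nested subintervals, starting from [[1/3, 1/2]], discard the zeros of one coordinate after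
   another; [a4] lies in all of them. *)
have [a1 [c1 [a1l ac1 c1l n1]]] := nonzero_subinterval (@oo false false) (@touching_x false) h0 h01 h1.
have a10 := lt_trans h0 a1l; have c11 := lt_trans c1l h1.
have [a2 [c2 [a2l ac2 c2l n2]]] := nonzero_subinterval (@oo true false) (@touching_x true) a10 ac1 c11.
have a20 := lt_trans a10 a2l; have c21 := lt_trans c2l c11.
have [a3 [c3 [a3l ac3 c3l n3]]] := nonzero_subinterval (@oo false true) (@ty false) a20 ac2 c21.
have a30 := lt_trans a20 a3l; have c31 := lt_trans c3l c21.
have [a4 [c4 [a4l ac4 c4l n4]]] := nonzero_subinterval (@oo true true) (@ty true) a30 ac3 c31.
have a40 := lt_trans a30 a4l; have c41 := lt_trans c4l c31.
have t01 : 0 < a4 < 1 by rewrite a40 (lt_trans ac4).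
have t01' : 0 <= a4 <= 1 by rewrite !ltW//; case/andP: t01.
have pos j : Z j false a4 != 0 -> 0 < Z j false a4.
  by move=> n; rewrite lt_neqAle eq_sym n x_coords_ge0.
have X1 : 0 < Z false false a4 by apply: pos; apply: n1; apply/andP; split; lra.
have X2 : 0 < Z true false a4 by apply: pos; apply: n2; apply/andP; split; lra.
have Y1 : Z false true a4 != 0 by apply: n3; apply/andP; split; lra.
have Y2 : Z true true a4 != 0 by apply: n4; apply/andP; split; lra.
have YY := y_coords_opposite t01 X1 X2.
have [S1|S1] := constant_sign (is_H1_within_continuous (hZ false true)) (@ty false);
have [S2|S2] := constant_sign (is_H1_within_continuous (hZ true true)) (@ty true).
- have p1 : 0 < Z false true a4 by rewrite lt_neqAle eq_sym Y1 S1.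
  have p2 : 0 < Z true true a4 by rewrite lt_neqAle eq_sym Y2 S2.
  by move: YY; rewrite leNgt mulr_gt0.
- by left => t tt; split; [exact: S1|exact: S2].
- by right => t tt; split; [exact: S1|exact: S2].
- have p1 : Z false true a4 < 0 by rewrite lt_neqAle Y1 S1.
  have p2 : Z true true a4 < 0 by rewrite lt_neqAle Y2 S2.
  by move: YY; rewrite leNgt nmulr_rgt0 ?p2.
Qed.

End Quadrants.

(** By the end relations, [Z2(1)] in the open fourth quadrant forces [Z1(1)] into the open first
    one; [Z1y(1) > 0] then excludes the mirrored sign pattern. With both endpoints on the x-axis the
    two mirror images remain possible. *)
Theorem theorem5p8 (R : realType) (q v : path3 R) :
  is_minimizer q v ->
  collision_free_on_0_1 q ->
  Z1 q 0 = (0, 0) ->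
  Z2 q 0 <> (0, 0) ->
  on_pos_xaxis (Z2 q 0) ->
  inQ1bar (Z1 q 1) ->
  inQ4bar (Z2 q 1) ->
  ((inQ1 (Z1 q 1) \/ inQ4 (Z2 q 1)) ->
     forall t, 0 <= t <= 1 -> inQ1bar (Z1 q t) /\ inQ4bar (Z2 q t))
  /\
  ((on_pos_xaxis (Z1 q 1) /\ on_pos_xaxis (Z2 q 1)) ->
     (forall t, 0 <= t <= 1 -> inQ1bar (Z1 q t) /\ inQ4bar (Z2 q t)) \/
     (forall t, 0 <= t <= 1 -> inQ4bar (Z1 q t) /\ inQ1bar (Z2 q t))).
Proof.
move=> mq cf _ _ [z20 _] [z1x z1y] [z2x z2y].
have mZ := jmin_jacobi mq.
have [[_ [_ _ _ _ [ex ey]]] _] := mZ.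
have nc t : 0 < t < 1 -> jnocoll (conf_at (jacobi q) t).
  move=> /andP[t0 t1]; have t01 : 0 < t <= 1 by rewrite t0 ltW.
  have [n12 [n13 n23]] := cf t t01.
  have psub0 (a b : pt R) : a != b -> psub a b != (0, 0).
    case: a b => [a1 a2] [b1 b2]; apply: contra.
    by rewrite /psub !xpair_eqE/= !subr_eq0.
  split.
  - apply: contra (psub0 _ _ n12) => /eqP e; apply/eqP.
    rewrite -e /pairv /conf_at /jacobi /Z1 /Z2 /psub /pscale /padd/=.
    by congr pair; ring.
  - have n31 : q b3 t != q b1 t by rewrite eq_sym.
    apply: contra (psub0 _ _ n31) => /eqP e; apply/eqP.
    rewrite -e /pairv /conf_at /jacobi /Z1 /Z2 /psub /pscale /padd/=.
    by congr pair; field.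
  - have n32 : q b3 t != q b2 t by rewrite eq_sym.
    apply: contra (psub0 _ _ n32) => /eqP e; apply/eqP.
    rewrite -e /pairv /conf_at /jacobi /Z1 /Z2 /psub /pscale /padd/=.
    by congr pair; field.
have X j : 0 < (Z1 q 1).1 -> forall t, 0 <= t <= 1 -> 0 <= jacobi q j false t.
  by move=> p t; exact: (x_coords_ge0 mZ nc).
have Y : 0 < (Z1 q 1).1 ->
    (forall t, 0 <= t <= 1 -> 0 <= jacobi q false true t /\ jacobi q true true t <= 0) \/
    (forall t, 0 <= t <= 1 -> jacobi q false true t <= 0 /\ 0 <= jacobi q true true t).
  by move=> p; exact: (minimizer_y_signs mZ nc).
split.
- move=> H.
  have [px py] : 0 < (Z1 q 1).1 /\ 0 < (Z1 q 1).2.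
    case: H => [[//]|[p1 p2]].
    have ex' : (Z2 q 1).1 = 3 / 2 * (Z1 q 1).1 := ex.
    have ey' : (Z1 q 1).2 = - 2 * (Z2 q 1).2 := ey.
    by split; lra.
  move=> t t01; have [S|S] := Y px.
    have [y1 y2] := S t t01; split; split.
    * exact: (X false px t t01).
    * exact: y1.
    * exact: (X true px t t01).
    * exact: y2.
  have := S 1; rewrite ler01 lexx => /(_ isT)[y1 _].
  have y1' : (Z1 q 1).2 <= 0 := y1.
  by move: y1'; rewrite leNgt py.
- move=> [[px _] _]; have [S|S] := Y px.
  + left => t t01; have [y1 y2] := S t t01.
    split; split.
    * exact: (X false px t t01).
    * exact: y1.
    * exact: (X true px t t01).
    * exact: y2.
  + right => t t01; have [y1 y2] := S t t01.
    split; split.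
    * exact: (X false px t t01).
    * exact: y1.
    * exact: (X true px t t01).
    * exact: y2.
Qed.
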